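(* Let $\dot{\mathbf U}^{\imath}=\dot{\mathbf U}^{\imath}_0\oplus\dot{\mathbf U}^{\imath}_1$ be the modified form of $\mathbf U^{\imath}(\mathfrak{sl}_2)$ with its geometrically defined canonical basis elements $b_{\check A_{0,d}}$, $b_{\check A_{1,d}}$, $d\in\mathbb N$, and identify each summand $\dot{\mathbf U}^{\imath}_{\varepsilon}$ ($\varepsilon\in\{0,1\}$) with the polynomial ring $\mathbb Q(v)[t]$, as specified in the context. Then the canonical basis elements are given as follows: for every $d\in\mathbb N$, $$b_{\check A_{0,d}}=\frac{(t+\llbracket d-1\rrbracket)(t+\llbracket d-3\rrbracket)\cdots(t+\llbracket -d+3\rrbracket)(t+\llbracket -d+1\rrbracket)}{\llbracket d\rrbracket!}=\frac{1}{\llbracket d\rrbracket!}\prod_{i=1}^{d}\bigl(t+\llbracket d+1-2i\rrbracket\bigr),$$ and $$b_{\check A_{1,d+1}}=\frac{t\cdot(t+\llbracket d-1\rrbracket)(t+\llbracket d-3\rrbracket)\cdots(t+\llbracket -d+3\rrbracket)(t+\llbracket -d+1\rrbracket)}{\llbracket d+1\rrbracket!}=\frac{t}{\llbracket d+1\rrbracket!}\prod_{i=1}^{d}\bigl(t+\llbracket d+1-2i\rrbracket\bigr).$$ Here the element $b_{\check A_{0,d}}$ lies in the copy $\dot{\mathbf U}^{\imath}_{\varepsilon}\cong\mathbb Q(v)[t]$ with $\varepsilon\equiv d \pmod 2$, and so does $b_{\check A_{1,d+1}}$.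
   Context: Notation. $\mathbb N=\{0,1,2,\dots\}$; $v$ is an indeterminate; $\mathcal A=\mathbb Z[v,v^{-1}]$. For $n\in\mathbb Z$, $\llbracket n\rrbracket=(v^n-v^{-n})/(v-v^{-1})$; for $n\in\mathbb N$, $\llbracket n\rrbracket!=\prod_{i=1}^n\llbracket i\rrbracket$ (so $\llbracket 0\rrbracket!=1$). The algebra $\mathbf S^{\jmath}_{3,d}$. Let $d\in\mathbb N$ and let $q$ be an odd prime power. Equip $\mathbb F_q^{2d+1}$ with a nondegenerate symmetric bilinear form, with orthogonal group $G$. Let $X$ be the set of flags $V=(0=V_0\subseteq V_1\subseteq V_2\subseteq V_3=\mathbb F_q^{2d+1})$ with $V_2=V_1^{\perp}$ (so $V_1$ is isotropic). The $G$-orbits $\mathcal O_A$ on $X\times X$ are indexed, independently of $q$, by the $3\times3$ matrices $A=(a_{ij})$ with entries in $\mathbb N$ summing to $2d+1$ and $a_{ij}=a_{4-i,4-j}$, via $a_{ij}=\dim\frac{V_{i-1}+V_i\cap V_j'}{V_{i-1}+V_i\cap V'_{j-1}}$ for $(V,V')\in\mathcal O_A$. The $G$-invariant functions on $X\times X$ form an algebra under convolution $(g*h)(V,V')=\sum_{V''\in X}g(V,V'')h(V'',V')$; its structure constants with respect to the characteristic functions $e_A$ of the orbits $\mathcal O_A$ are polynomial in $q$. The generic version, with $q=v^2$, is an $\mathcal A$-algebra with $\mathcal A$-basis $\{e_A\}$; $\mathbf S^{\jmath}_{3,d}$ is its extension of scalars to $\mathbb Q(v)$. It is generated by the elements $\mathbf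 e,\mathbf f,\mathbf d_1^{\pm1},\mathbf d_2^{\pm1}$ which specialize at $v=\sqrt q$ to the functions: $\mathbf e(V,V')=v^{-\dim(V_2'/V_1')}$ if $V_1\subset V_1'$ with codimension one, and $0$ otherwise; $\mathbf f(V,V')=v^{-\dim V_1'}$ if $V_1\supset V_1'$ with codimension one, and $0$ otherwise; $\mathbf d_a^{\pm1}(V,V')=v^{\mp\dim(V_a'/V_{a-1}')}$ if $V=V'$, and $0$ otherwise ($a=1,2$). Put $\mathbf k=\mathbf d_1\mathbf d_2^{-1}$. The algebra $\mathbf S^{\imath}_{2,d}$ and its canonical basis. For $a,b\in\mathbb N$ let $$A_{a,b}=\begin{bmatrix} a & 0 & b \\ 0 & 1 & 0 \\ b & 0 & a \end{bmatrix}.$$ For $a+b=d$, $\mathcal O_{A_{a,b}}$ is the set of pairs $(V,V')$ with $V_1,V_1'$ maximal isotropic (dimension $d$) and $\dim(V_1\cap V_1')=a$. Put $[A_{a,b}]=v^{-(ab+b(b+1)/2)}e_{A_{a,b}}$. The element $\mathbf j_d=[A_{d,0}]$ is an idempotent; set $\mathbf S^{\imath}_{2,d}=\mathbf j_d\mathbf S^{\jmath}_{3,d}\mathbf j_d$, an algebra with unit $\mathbf j_d$ and $\mathbb Q(v)$-basis $\{[A_{a,b}]: a+b=d\}$. The canonical basis element $\{A_{a,b}\}$ ($a+b=d$) is the one attached to the intersection cohomology complex of the closure of $\mathcal O_{A_{a,b}}$; equivalently, it is the unique element of $[A_{a,b}]+\sum_{b'<b}v^{-1}\mathbb Z[v^{-1}]\,[A_{d-b',b'}]$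 fixed by the bar involution, i.e. by the ring involution of $\mathbf S^{\jmath}_{3,d}$ with $v\mapsto v^{-1}$, $\mathbf e\mapsto\mathbf e$, $\mathbf f\mapsto\mathbf f$, $\mathbf d_a\mapsto\mathbf d_a^{-1}$ (restricted to $\mathbf S^{\imath}_{2,d}$). Let $$\mathbf t_d=\Bigl(\mathbf f\mathbf e+\frac{\mathbf k-\mathbf k^{-1}}{v-v^{-1}}\Bigr)\mathbf j_d\in\mathbf S^{\imath}_{2,d},$$ which generates $\mathbf S^{\imath}_{2,d}$ as a unital $\mathbb Q(v)$-algebra. The modified form and its canonical basis. There are surjective unital algebra homomorphisms (transfer maps) $\phi^{\imath}_{d+2,d}:\mathbf S^{\imath}_{2,d+2}\to\mathbf S^{\imath}_{2,d}$ with $\mathbf t_{d+2}\mapsto\mathbf t_d$. Declare $A_{a,b}\sim A_{a',b'}$ if $a\equiv a'\pmod 2$ and $b=b'$, and let $\check A_{a,b}$ be the class of $A_{a,b}$. The canonical basis element $b_{\check A_{a,b}}$ is the element of the inverse limit of the $\mathbf S^{\imath}_{2,d}$ along the transfer maps, over $d\equiv a+b\pmod 2$, whose component in $\mathbf S^{\imath}_{2,a+b+2p}$ equals $\{A_{a+2p,b}\}$ for all sufficiently large $p$. The modified form $\dot{\mathbf U}^{\imath}$ is the $\mathbb Q(v)$-space with basis all $b_{\check A_{0,d}}$, $b_{\check A_{1,d}}$, $d\in\mathbb N$; it equals $\dot{\mathbf U}^{\imath}_0\oplus\dot{\mathbf U}^{\imath}_1$ as an algebra, where $\dot{\mathbf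 U}^{\imath}_0$ is spanned by $b_{\check A_{0,d}},b_{\check A_{1,d+1}}$ with $d$ even and $\dot{\mathbf U}^{\imath}_1$ is spanned by $b_{\check A_{0,d}},b_{\check A_{1,d-1}}$ with $d$ odd. Each $\dot{\mathbf U}^{\imath}_\varepsilon$ is identified with $\mathbb Q(v)[t]$ so that the component in $\mathbf S^{\imath}_{2,d}$ (for $d\equiv\varepsilon$ mod 2) is given by $\phi^{\imath}_d:\mathbb Q(v)[t]\to\mathbf S^{\imath}_{2,d}$, $t\mapsto\mathbf t_d$; that is, $t$ is the compatible family $(\mathbf t_d)_d$. Under this identification $b_{\check A_{1,1}}\mapsto t$ in $\dot{\mathbf U}^{\imath}_0$ and $b_{\check A_{0,1}}\mapsto t$ in $\dot{\mathbf U}^{\imath}_1$. *)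

(* Defs.v *)
From HB Require Import structures.
From mathcomp Require Import all_boot all_order all_algebra all_field.
From mathcomp Require Import zify.

Set Implicit Arguments.
Unset Strict Implicit.
Unset Printing Implicit Defensive.

Import GRing.Theory.
Local Open Scope ring_scope.

Notation Qv := {fraction {poly rat}}.

Definition v : Qv := FracField.tofrac 'X.

Definition qint (n : int) : Qv := (v ^ n - v ^ (- n)) / (v - v^-1).

Definition qfact (n : nat) : Qv := \prod_(1 <= i < n.+1) qint i%:Z.

Section Flags.
Variables (F : finFieldType) (n : nat) (J : 'M[F]_n).

(* Subspaces of F^n are row spaces of square matrices.  [J] is the Gram
   matrix of the form, so [perp U] is the space of x with x J u^T = 0 for all
   u in U. *)
Definition perp (U : 'M[F]_n) : 'M[F]_n := kermx (J *m U^T).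

(* The flag 0 <= V_1 <= V_2 <= F^n with V_2 = V_1^perp is determined by V_1,
   represented by the canonical generator of its row space, so that equality
   in [flag] is equality of flags. *)
Definition flag :=
  {U : 'M[F]_n | (<<U>>%MS == U) && (U <= perp U)%MS}.

Definition step (V : flag) (i : nat) : 'M[F]_n :=
  match i with
  | 0 => 0
  | 1 => val V
  | 2 => perp (val V)
  | _ => 1%:M
  end.

(* The dimension of a quotient of nested subspaces is a difference of ranks.
   Rows and columns are numbered from 0, so entry (i, j) is the one usually
   numbered (i + 1, j + 1). *)
Definition relpos (V V' : flag) : 'M[nat]_3 :=
  \matrix_(i < 3, j < 3)
    (\rank (step V i + step V i.+1 :&: step V' j.+1)%MS
     - \rank (step V i + step V i.+1 :&: step V' j)%MS)%N.

End Flags.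

Definition rdim (A : 'M[nat]_3) (i : 'I_3) : nat := (\sum_(j < 3) A i j)%N.
Definition cdim (A : 'M[nat]_3) (j : 'I_3) : nat := (\sum_(i < 3) A i j)%N.

Definition in_Xi (d : nat) (A : 'M[nat]_3) : bool :=
  ((\sum_(i < 3) \sum_(j < 3) A i j)%N == d.*2.+1)
  && [forall i, forall j, A i j == A (rev_ord i) (rev_ord j)].

(* All entries are at most 2d+1, so filtering the matrices over 'I_(2d+2)
   yields a duplicate-free enumeration of all matrices satisfying [in_Xi d]. *)
Definition Xi (d : nat) : seq 'M[nat]_3 :=
  [seq B <- [seq map_mx (@nat_of_ord _) A | A : 'M['I_(d.*2.+2)]_3]
     | in_Xi d B].

Definition Aab (a b : nat) : 'M[nat]_3 :=
  \matrix_(i < 3, j < 3)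
    (if (i == 1) && (j == 1) then 1%N
     else if (i == 1) || (j == 1) then 0%N
     else if i == j then a else b).

Definition orbit_count (F : finFieldType) n (J : 'M[F]_n) (A B : 'M[nat]_3)
    (V V' : flag J) : nat :=
  #|[set W : flag J | (relpos V W == A) && (relpos W V' == B)]|.

(* A model of the generic convolution algebra over Q(v); e_A stands for the
   characteristic function of the set of pairs of flags of relative position
   A, which is an orbit of the orthogonal group.
   [sj_const A B C] is the polynomial in q giving the coefficient of e_C in
   e_A e_B; the indeterminate q is specialized to v^2.  Values of [sj_e]
   outside [Xi d] are irrelevant. *)
Record schurJ (d : nat) := SchurJ {
  sj_alg :> falgType Qv;
  sj_e : 'M[nat]_3 -> sj_alg;
  sj_const : 'M[nat]_3 -> 'M[nat]_3 -> 'M[nat]_3 -> {poly int};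
  sj_basis : basis_of fullv [seq sj_e A | A <- Xi d];
  sj_mul : {in Xi d &, forall A B, sj_e A * sj_e B =
    \sum_(C <- Xi d) (map_poly intr (sj_const A B C)).[v ^+ 2] *: sj_e C};
  sj_constP : {in Xi d &, forall A B,
    forall (F : finFieldType) (J : 'M[F]_(d.*2.+1)) (V V' : flag J),
      odd #|F| -> J^T = J -> J \in unitmx ->
      (sj_const A B (relpos V V')).[#|F|%:Z] = (orbit_count A B V V')%:Z}
}.

(* The values of the generators on the orbit of A.  The row and column sums of
   A are the dimensions of V_i/V_(i-1) and V'_j/V'_(j-1); [ecoefE], [fcoefE]
   and [dcoefE] below express these functions in terms of flags. *)
Definition ecoef (A : 'M[nat]_3) : Qv :=
  if [&& A 0 1 == 0%N, A 0 2 == 0%N & cdim A 0 == (rdim A 0).+1]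
  then v ^- cdim A 1 else 0.

Definition fcoef (A : 'M[nat]_3) : Qv :=
  if [&& A 1 0 == 0%N, A 2 0 == 0%N & rdim A 0 == (cdim A 0).+1]
  then v ^- cdim A 0 else 0.

Definition dcoef (a : 'I_3) (A : 'M[nat]_3) : Qv :=
  if [forall i, forall j, (i != j) ==> (A i j == 0%N)]
  then v ^- cdim A a else 0.

Section SchurJ.
Variables (d : nat) (S : schurJ d).

Definition of_coef (g : 'M[nat]_3 -> Qv) : S :=
  \sum_(A <- Xi d) g A *: sj_e S A.

Definition eJ : S := of_coef ecoef.
Definition fJ : S := of_coef fcoef.

(* d_1 and d_2; the inverses in the ring S are their inverses d_1^-1, d_2^-1,
   given by the inverse powers of v on the diagonal. *)
Definition d1J : S := of_coef (dcoef 0).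
Definition d2J : S := of_coef (dcoef 1).
Definition kJ : S := d1J / d2J.

(* [A_(a,b)], meaningful when a + b = d. *)
Definition stdI (a b : nat) : S := v ^- (a * b + (b * b.+1)./2) *: sj_e S (Aab a b).

Definition jI : S := stdI d 0.

Definition SI : {vspace S} := (<[jI]> * fullv * <[jI]>)%VS.

Definition tI : S := (fJ * eJ + (v - v^-1)^-1 *: (kJ - kJ^-1)) * jI.

(* The unital morphism Q(v)[t] -> SI with t |-> tI: since SI has unit jI, the
   constant term has to be multiplied by jI. *)
Definition phiI (p : {poly Qv}) : S := horner_alg tI p * jI.

Definition bar_involution (bar : {rmorphism S -> S}) : Prop :=
  [/\ involutive bar,
      bar (v *: 1) = v^-1 *: 1,
      bar eJ = eJ /\ bar fJ = fJ
    & bar d1J = d1J^-1 /\ bar d2J = d2J^-1].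

Definition in_vinvZ (c : Qv) : Prop :=
  exists p : {poly int}, c = v^-1 * (map_poly intr p).[v^-1].

(* x is the canonical basis element {A_(d-b,b)}, for b <= d, singled out by
   bar-invariance and unitriangularity. *)
Definition is_canonical (bar : {rmorphism S -> S}) (b : nat) (x : S) : Prop :=
  bar x = x /\
  exists c : 'I_b -> Qv,
    (forall b', in_vinvZ (c b')) /\
    x = stdI (d - b) b + \sum_(b' < b) c b' *: stdI (d - b') b'.

End SchurJ.

Definition transfer d (S2 : schurJ d.+2) (S : schurJ d) (phi : S2 -> S) : Prop :=
  [/\ {in SI S2, forall x, phi x \in SI S} /\
      {in SI S, forall y, exists2 x, x \in SI S2 & phi x = y},
      forall a : Qv, {in SI S2 &, forall x y, phi (a *: x + y) = a *: phi x + phi y},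
      {in SI S2 &, {morph phi : x y / x * y}},
      phi (jI S2) = jI S
    & phi (tI S2) = tI S].

Section Modified.
Variables (S : forall d, schurJ d) (bar : forall d, {rmorphism S d -> S d}).
Variable phi : forall d, S d.+2 -> S d.

(* An element of the limit over all d of parity eps is given by a family
   indexed by all d, of which only the components of that parity matter. *)
Definition in_limit (eps : bool) (x : forall d, S d) : Prop :=
  forall d, odd d = eps -> x d \in SI (S d) /\ phi (x d.+2) = x d.

Definition eq_limit (eps : bool) (x y : forall d, S d) : Prop :=
  forall d, odd d = eps -> x d = y d.

(* x is the canonical basis element attached to the class of A_(a,b); its
   component at a + b + 2p is eventually {A_(a+2p,b)}. *)
Definition is_bcheck (a b : nat) (x : forall d, S d) : Prop :=
  in_limit (odd (a + b)) x /\
  exists p0, forall p, (p0 <= p)%N ->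
    is_canonical (@bar (a + b + p.*2)) b (x (a + b + p.*2)%N).

(* The identification of Q(v)[t] with a subspace of the limit. *)
Definition family_of_poly (P : {poly Qv}) : forall d, S d :=
  fun d => phiI (S d) P.

End Modified.

Section FlagLemmas.
Variables (F : finFieldType) (n : nat) (J : 'M[F]_n).
Implicit Types V : flag J.

Local Notation r V V' i j := (\rank (step V i :&: step V' j)%MS).

Lemma step_sub V i : (step V i <= step V i.+1)%MS.
Proof.
case/andP: (valP V) => _ h.
by case: i => [|[|[|i]]] /=; rewrite ?sub0mx ?submx1.
Qed.

Lemma relposE V V' (i j : 'I_3) :
  (relpos V V' i j + r V V' i j.+1 + r V V' i.+1 j
   = r V V' i.+1 j.+1 + r V V' i j)%N.
Proof.
rewrite mxE.
have E k : (\rank (step V i + step V i.+1 :&: step V' k)%MS + r V V' i k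
            = \rank (step V i) + r V V' i.+1 k)%N.
  rewrite -(mxrank_sum_cap (step V i) (step V i.+1 :&: step V' k)%MS).
  congr addn; apply: eqmx_rank; rewrite capmxA; apply/andP; split.
    by apply: capmxS => //; rewrite sub_capmx submx_refl step_sub.
  by apply: capmxS => //; exact: capmxSl.
have := E j; have := E j.+1.
have : (\rank (step V i + step V i.+1 :&: step V' j)%MS <=
        \rank (step V i + step V i.+1 :&: step V' j.+1)%MS)%N.
  apply: mxrankS; apply: addsmxS => //; apply: capmxS => //; exact: step_sub.
lia.
Qed.

Lemma rank_step_le V i : (\rank (step V i) <= \rank (step V i.+1))%N.
Proof. exact: mxrankS (step_sub V i). Qed.

Lemma r0l V V' j : r V V' 0 j = 0%N.
Proof. by rewrite /= cap0mx mxrank0. Qed.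
Lemma r0r V V' i : r V V' i 0 = 0%N.
Proof. by rewrite /= capmx0 mxrank0. Qed.
Lemma r3l V V' j : r V V' 3 j = \rank (step V' j).
Proof. by rewrite /= cap1mx. Qed.
Lemma r3r V V' i : r V V' i 3 = \rank (step V i).
Proof. by rewrite /= capmx1. Qed.

Lemma relpos_eqs V V' :
  let A := relpos V V' in
  [/\ rdim A 0 = \rank (step V 1), cdim A 0 = \rank (step V' 1),
      cdim A 1 = (\rank (step V' 2) - \rank (step V' 1))%N,
      (A 0%R 1%R + A 0%R 2%R + r V V' 1 1 = \rank (step V 1))%N
    & (A 1%R 0%R + A 2%R 0%R + r V V' 1 1 = \rank (step V' 1))%N].
Proof.
move=> A; rewrite /rdim /cdim !big_ord_recl !big_ord0.
have h (i j : 'I_3) := relposE V V' i j.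
have := rank_step_le V' 1.
have e1 : lift ord0 ord0 = 1 :> 'I_3 by apply/val_inj.
have e2 : lift ord0 (lift ord0 ord0) = 2 :> 'I_3 by apply/val_inj.
have e0 : ord0 = 0 :> 'I_3 by [].
rewrite !e2 !e1 !e0 -/A.
move: (h 0 0) (h 0 1) (h 0 2) (h 1 0) (h 1 1) (h 1 2) (h 2 0) (h 2 1) (h 2 2).
rewrite -/A.
have -> : nat_of_ord (2 : 'I_3) = 2%N by [].
have -> : nat_of_ord (1 : 'I_3) = 1%N by [].
have -> : nat_of_ord (0 : 'I_3) = 0%N by [].
rewrite !r0l !r0r !r3l !r3r.
by move=> *; split; lia.
Qed.

Lemma sub_rankE (U W : 'M[F]_n) : (U <= W)%MS = (\rank (U :&: W)%MS == \rank U).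
Proof.
by rewrite (mxrank_leqif_sup (capmxSl U W)) sub_capmx submx_refl.
Qed.

Lemma ecoefE V V' : ecoef (relpos V V') =
  if (step V 1 <= step V' 1)%MS && (\rank (step V' 1) == (\rank (step V 1)).+1)
  then v ^- (\rank (step V' 2) - \rank (step V' 1))%N else 0.
Proof.
have [h1 h2 h3 h4 _] := relpos_eqs V V'.
rewrite /ecoef h1 h2 h3 sub_rankE andbA; congr (if _ && _ then _ else _); lia.
Qed.

Lemma fcoefE V V' : fcoef (relpos V V') =
  if (step V' 1 <= step V 1)%MS && (\rank (step V 1) == (\rank (step V' 1)).+1)
  then v ^- \rank (step V' 1) else 0.
Proof.
have [h1 h2 h3 _ h4] := relpos_eqs V V'.
rewrite /fcoef h1 h2 sub_rankE capmxC andbA; congr (if _ && _ then _ else _); lia.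
Qed.

Lemma relpos_diag V V' :
  [forall i, forall j, (i != j) ==> (relpos V V' i j == 0%N)] = (V == V').
Proof.
apply/idP/eqP => [H|<-].
  have h i j : i != j -> relpos V V' i j = 0%N.
    by move: H => /forallP/(_ i)/forallP/(_ j)/implyP H /H /eqP.
  have [_ _ _ ] := relpos_eqs V V'; rewrite !h //= !add0n => h1 h2.
  apply: val_inj; case/andP: (valP V) => /eqP <- _; case/andP: (valP V') => /eqP <- _.
  apply/genmxP; rewrite !sub_rankE; apply/andP; split; apply/eqP => //.
  by rewrite -h2 capmxC.
have mono i j : (i <= j)%N -> (step V i <= step V j)%MS.
  elim: j => [|j IH]; first by rewrite leqn0 => /eqP ->.
  rewrite leq_eqVlt => /predU1P[->//|/IH h]; exact: submx_trans h (step_sub V j).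
apply/forallP => i; apply/forallP => j; apply/implyP => ij.
have rE a b : r V V a b = \rank (step V (minn a b)).
  case/orP: (leq_total a b) => ab.
    by rewrite (minn_idPl ab); have /capmx_idPl-> := mono _ _ ab.
  by rewrite capmxC (minn_idPr ab); have /capmx_idPl-> := mono _ _ ab.
have := relposE V V i j; rewrite !rE.
have ij' : (i != j :> nat) by [].
case: (ltngtP i j) ij' => // h _.
  have -> : minn i j.+1 = i by lia.
  have -> : minn i.+1 j = i.+1 by lia.
  have -> : minn i.+1 j.+1 = i.+1 by lia.
  lia.
have -> : minn i j.+1 = j.+1 by lia.
have -> : minn i.+1 j = j by lia.
have -> : minn i.+1 j.+1 = j.+1 by lia.
lia.
Qed.

Lemma dcoefE V V' : (dcoef 0 (relpos V V') =
    if V == V' then v ^- \rank (step V' 1) else 0) *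
  (dcoef 1 (relpos V V') =
    if V == V' then v ^- (\rank (step V' 2) - \rank (step V' 1))%N else 0).
Proof.
by have [_ h2 h3 _ _] := relpos_eqs V V'; rewrite /dcoef relpos_diag h2 h3.
Qed.

End FlagLemmas.

(* Main.v *)
Require Import Defs.
From HB Require Import structures.
From mathcomp Require Import all_boot all_order all_algebra all_fingroup all_field.
From mathcomp Require Import mxabelem.
From mathcomp Require Import zify ring.

(* Write q = v^2, X_b = [A_(d-b,b)] and t = t_d.  Counting flags over finite
   fields of odd order determines two products: that of e_E, where E is the
   orbit of the pairs V_1 < V'_1 with V_1 a hyperplane of the maximal isotropic
   V'_1, with e_(A_(d-b,b)) (a conic has q + 1 points, one of which is special),
   and that of e_(E^T) with each term of the former (hyperplanes of V_1
   containing or not V_1 :&: V'_1).  As f e j_d = v^-d e_(E^T) e_E, this gives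
     t X_b = [b+1] X_(b+1) + v^(2b-d) X_b + v^(2b-d-1) [d-b+1] X_(b-1).
   With a = d - b and Gauss binomials in v^4, put
     B_b = sum_k v^-(ak + k(k+1)/2) binom(ceil(a/2) + floor(k/2), floor(k/2)) X_(b-k).
   (The binomials are suggested by the intersection cohomology of Pfaffian
   varieties.)  The coefficients with k > 0 lie in v^-1 Z[v^-1], and
     t B_b = [b+1] B_(b+1) + (a odd) [b] B_(b-1).
   Since t and B_0 = j_d are fixed by the bar involution, so is every B_b, which
   is thus the canonical basis element; and the recursion is solved by the
   products of the theorem. *)

Set Implicit Arguments.
Unset Strict Implicit.
Unset Printing Implicit Defensive.

Import GRing.Theory.
Local Open Scope ring_scope.

(** * Orthogonal complements and relative positions *)

(** The structure constants are known only through counts over finite fields of odd order, and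
    [sj_constP] gives the same value for all pairs of flags of a given relative position. One
    explicit pair for each matrix and field is therefore enough: it is taken in a coordinate model
    whose form is the permutation matrix of an involution. Prime fields already give infinitely many
    values of each polynomial. The bar involution is given only on v and on the generators; that it
    fixes j_d is deduced from d_1, of which j_d is the spectral projection for the extreme
    eigenvalue v^-d. In the family attached to the class of A_(a,b), the number d - b keeps the
    parity of a, and the recursion depends on d only through this parity. Hence all components are
    given by one polynomial in t. For d - b even, two steps of the recursion give [b+2] [b+1]
    B_(b+2) = (t^2 - [b+1]^2) B_b, and t + [b+1], t - [b+1] are the two outer factors of the next
    product; for d - b odd, one more multiplication by t suffices. *)

Section Perp.
Variables (F : finFieldType) (n : nat) (J : 'M[F]_n).
Hypotheses (Jsym : J^T = J) (Junit : J \in unitmx).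
Implicit Types U W : 'M[F]_n.

Lemma sub_perp m (A : 'M[F]_(m, n)) U : (A <= perp J U)%MS = (A *m J *m U^T == 0).
Proof. by rewrite sub_kermx mulmxA. Qed.

Lemma rank_perp U : \rank (perp J U) = (n - \rank U)%N.
Proof. by rewrite mxrank_ker -mxrank_tr trmx_mul trmxK mxrankMfree // row_free_unit unitmx_tr. Qed.

Lemma sub_perpC U W : (U <= perp J W)%MS = (W <= perp J U)%MS.
Proof.
by rewrite !sub_perp -[in LHS]trmx_eq0 !trmx_mul trmxK Jsym mulmxA.
Qed.

Lemma perpS U W : (U <= W)%MS -> (perp J W <= perp J U)%MS.
Proof. by move=> UW; rewrite sub_perpC (submx_trans UW) // sub_perpC. Qed.

Lemma perp_cap U W : (perp J U :&: perp J W :=: perp J (U + W)%MS)%MS.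
Proof.
apply/eqmxP/andP; split; last by rewrite sub_capmx !perpS ?addsmxSl ?addsmxSr.
by rewrite sub_perpC addsmx_sub sub_perpC capmxSl sub_perpC capmxSr.
Qed.

Lemma rank_perp_cap U W :
  (\rank (perp J U :&: perp J W)%MS + \rank U + \rank W
   = n + \rank (U :&: W)%MS)%N.
Proof.
rewrite perp_cap rank_perp; have := mxrank_sum_cap U W.
have := rank_leq_col (U + W)%MS; lia.
Qed.

Lemma perpK U : (perp J (perp J U) :=: U)%MS.
Proof.
have sub : (U <= perp J (perp J U))%MS by rewrite sub_perpC.
apply/eqmx_sym/eqmxP; rewrite -(geq_leqif (mxrank_leqif_eq sub)) !rank_perp.
by have := rank_leq_col U; lia.
Qed.

End Perp.

Lemma I3_ind (P : 'I_3 -> Prop) : P 0 -> P 1 -> P 2 -> forall i, P i.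
Proof.
move=> p0 p1 p2 [[|[|[|//]]] hi].
- by rewrite (_ : Ordinal hi = 0) //; apply: val_inj.
- by rewrite (_ : Ordinal hi = 1) //; apply: val_inj.
- by rewrite (_ : Ordinal hi = 2) //; apply: val_inj.
Qed.

Lemma sum_I3 (f : 'I_3 -> nat) : (\sum_(i < 3) f i = f 0%R + f 1%R + f 2%R)%N.
Proof.
rewrite !big_ord_recl big_ord0 addn0 addnA.
by congr (f _ + f _ + f _)%N; apply: val_inj.
Qed.

Lemma rev0 : rev_ord (0 : 'I_3) = 2. Proof. exact: val_inj. Qed.
Lemma rev1 : rev_ord (1 : 'I_3) = 1. Proof. exact: val_inj. Qed.
Lemma rev2 : rev_ord (2 : 'I_3) = 0. Proof. exact: val_inj. Qed.
Definition revE := (rev0, rev1, rev2).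

Lemma XiP d (A : 'M[nat]_3) :
  reflect [/\ A 2 2 = A 0 0, A 2 1 = A 0 1, A 2 0 = A 0 2, A 1 2 = A 1 0
            & ((A 0%R 0%R + A 0%R 1%R + A 0%R 2%R + A 1%R 0%R).*2 + A 1%R 1%R = d.*2.+1)%N]
          (in_Xi d A).
Proof.
apply: (iffP andP) => [[/eqP tot sym]|[e22 e21 e20 e12 tot]].
  have h i j : A i j = A (rev_ord i) (rev_ord j).
    by move/forallP/(_ i)/forallP/(_ j)/eqP: sym.
  move: tot (h 2 2) (h 2 1) (h 2 0) (h 1 2); rewrite !sum_I3 !revE.
  by move=> tot -> -> -> e; split => //; move: tot; rewrite e (h 2 0) (h 2 1) (h 2 2) !revE; lia.
split; first by apply/eqP; rewrite !sum_I3 e22 e21 e20 e12; lia.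
by apply/forallP; elim/I3_ind; apply/forallP; elim/I3_ind; rewrite !revE; apply/eqP.
Qed.

Lemma mem_Xi d A : (A \in Xi d) = in_Xi d A.
Proof.
rewrite mem_filter andb_idr // => /XiP[e22 e21 e20 e12 tot].
apply/mapP; exists (map_mx (fun k => inord k : 'I_(d.*2.+2)) A); first by rewrite mem_enum.
apply/matrixP => i j; rewrite !mxE inordK //.
by elim/I3_ind: i; elim/I3_ind: j; lia.
Qed.

Lemma Xi_uniq d : uniq (Xi d).
Proof.
rewrite filter_uniq // map_inj_uniq ?enum_uniq //.
by move=> A B /matrixP h; apply/matrixP => i j; apply: val_inj; have := h i j; rewrite !mxE.
Qed.

(** Central symmetry leaves four free entries besides the central one, which the total then
    fixes. *)
Lemma Xi_eq d A B : in_Xi d A -> in_Xi d B ->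
  A 0 0 = B 0 0 -> A 0 1 = B 0 1 -> A 0 2 = B 0 2 -> A 1 0 = B 1 0 -> A = B.
Proof.
case/XiP=> a1 a2 a3 a4 a5 /XiP[b1 b2 b3 b4 b5] c1 c2 c3 c4.
apply/matrixP => i j.
by elim/I3_ind: i; elim/I3_ind: j; lia.
Qed.

Lemma rdimE A i : rdim A i = (A i 0%R + A i 1%R + A i 2%R)%N.
Proof. exact: sum_I3. Qed.

Lemma cdimE A j : cdim A j = (A 0%R j + A 1%R j + A 2%R j)%N.
Proof. exact: sum_I3. Qed.

(* The remaining entries are forced as soon as one of the two isotropic
   subspaces has the maximal dimension d. *)
Lemma Xi_eq_max d A B : in_Xi d A -> in_Xi d B ->
  (cdim A 0 == d) || (rdim A 0 == d) ->
  (A == B) = [&& rdim A 0 == rdim B 0, cdim A 0 == cdim B 0 & A 0 0 == B 0 0].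
Proof.
move=> hA hB hd; apply/eqP/and3P => [->//|[/eqP er /eqP ec /eqP e0]].
move/XiP: (hA) => [a1 a2 a3 a4 a5]; move/XiP: (hB) => [b1 b2 b3 b4 b5].
move: hd er ec; rewrite !rdimE !cdimE => hd er ec.
have [x1 x2] : A 0 1 = B 0 1 /\ A 1 0 = B 1 0 by case/orP: hd => /eqP hd; lia.
by apply: (Xi_eq hA hB) => //; lia.
Qed.

Lemma relpos_dims (F : finFieldType) n (J : 'M[F]_n) (V W : flag J) :
  [/\ rdim (relpos V W) 0 = \rank (val V), cdim (relpos V W) 0 = \rank (val W)
    & relpos V W 0 0 = \rank (val V :&: val W)%MS].
Proof.
have [-> -> _ _ _] := relpos_eqs V W; split=> //.
by have := relposE V W 0 0; rewrite /= cap0mx capmx0 !mxrank0 cap0mx mxrank0; lia.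
Qed.

Section RelposXi.
Variables (F : finFieldType) (d : nat) (J : 'M[F]_(d.*2.+1)).
Hypotheses (Jsym : J^T = J) (Junit : J \in unitmx).
Implicit Types V W : flag J.

Lemma rank_step_perp V i : (i <= 3)%N ->
  (\rank (step V (3 - i)) + \rank (step V i) = d.*2.+1)%N.
Proof.
have := rank_leq_col (val V); rewrite /step.
by case: i => [|[|[|[|//]]]] /= hV _; rewrite ?rank_perp ?mxrank0 ?mxrank1 //; lia.
Qed.

(** As the step of index 3 - i is the orthogonal of the step of index i, intersection ranks at
    opposite indices determine each other. This is the source of the central symmetry of
    [relpos]. *)
Lemma rank_step_cap V W i j : (i <= 3)%N -> (j <= 3)%N ->
  (\rank (step V (3 - i) :&: step W (3 - j))%MS + \rank (step V i) + \rank (step W j)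
  = d.*2.+1 + \rank (step V i :&: step W j)%MS)%N.
Proof.
have perp3 V' k : (k <= 3)%N -> (step V' (3 - k) :=: perp J (step V' k))%MS.
  case: k => [|[|[|[|//]]]] _ /=.
  - by apply/eqmxP; rewrite submx1 sub_perp trmx0 mulmx0 eqxx.
  - exact: eqmx_refl.
  - by apply: eqmx_sym; exact: perpK.
  - by apply/eqmxP; rewrite sub0mx submx0 -mxrank_eq0 rank_perp // mxrank1 subnn.
by move=> hi hj; rewrite (cap_eqmx (perp3 V i hi) (perp3 W j hj)) rank_perp_cap.
Qed.

Lemma relpos_in_Xi V W : in_Xi d (relpos V W).
Proof.
have h (i j : 'I_3) := relposE V W i j.
have p i j (hi : (i <= 3)%N) (hj : (j <= 3)%N) := rank_step_cap V W hi hj.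
have nV i (hi : (i <= 3)%N) := rank_step_perp V hi.
have nW i (hi : (i <= 3)%N) := rank_step_perp W hi.
move: (h 0 0) (h 0 1) (h 0 2) (h 1 0) (h 1 1) (h 1 2) (h 2 0) (h 2 1) (h 2 2).
have -> : nat_of_ord (2 : 'I_3) = 2%N by [].
have -> : nat_of_ord (1 : 'I_3) = 1%N by [].
have -> : nat_of_ord (0 : 'I_3) = 0%N by [].
move: (p 1%N 1%N isT isT) (p 1%N 2%N isT isT) (nV 1%N isT) (nW 1%N isT).
rewrite !r0l !r0r !r3l !r3r /=.
rewrite mxrank1 => *; apply/XiP; split; lia.
Qed.

Lemma relpos_eq_max V W A : in_Xi d A -> (cdim A 0 == d) || (rdim A 0 == d) ->
  (relpos V W == A) = [&& \rank (val V) == rdim A 0, \rank (val W) == cdim A 0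
                        & \rank (val V :&: val W)%MS == A 0 0].
Proof.
move=> hA hd; rewrite eq_sym (Xi_eq_max hA (relpos_in_Xi V W) hd).
by have [-> -> ->] := relpos_dims V W; rewrite ![_ == \rank _]eq_sym.
Qed.

Lemma flag_rank_le V : (\rank (val V) <= d)%N.
Proof.
have /andP[_ /mxrankS] := valP V; rewrite rank_perp //.
by have := rank_leq_col (val V); lia.
Qed.

End RelposXi.

(** * Counting hyperplanes *)

Section Hyperplanes.
Variables (F : finFieldType) (n : nat).
Implicit Types K U V : 'M[F]_n.

Local Notation ann U := (rowg (kermx U^T)).

Lemma mem_ann U (a : 'rV[F]_n) : (a \in ann U) = (U <= kermx a^T)%MS.
Proof. by rewrite mem_rowg !sub_kermx -[in LHS]trmx_eq0 trmx_mul trmxK. Qed.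

Lemma card_ann U : #|ann U| = (#|F| ^ (n - \rank U))%N.
Proof. by rewrite card_rowg mxrank_ker mxrank_tr. Qed.

Definition hyperplanes K V : {set 'M[F]_n} :=
  [set U | [&& <<U>>%MS == U, (K <= U)%MS, (U <= V)%MS & (\rank U).+1 == \rank V]].

(* Double counting of the pairs (a, U) where the linear form a vanishes on U
   but not on V. *)
Lemma card_hyperplanes K V : (K <= V)%MS ->
  #|hyperplanes K V| = (\sum_(i < \rank V - \rank K) #|F| ^ i)%N.
Proof.
move=> KV.
have q_gt1 := finNzRing_gt1 F; have v_le := rank_leq_col V; have kv := mxrankS KV.
have annS (A B : 'M[F]_n) : (A <= B)%MS -> ann B \subset ann A.
  by move=> AB; apply/subsetP => a; rewrite !mem_ann; exact: submx_trans.
pose f (a : 'rV[F]_n) := <<V :&: kermx a^T>>%MS.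
have rank_f a : a \notin ann V -> (\rank (V :&: kermx a^T)%MS).+1 = \rank V.
  rewrite mem_ann => aV.
  have a0 : a != 0 by apply: contraNneq aV => ->; rewrite trmx0 kermx0 submx1.
  have rk : \rank (kermx a^T) = n.-1 by rewrite mxrank_ker mxrank_tr rank_rV a0 subn1.
  have n0 : (0 < n)%N by case: (n) a a0 {aV rk} => // a; rewrite thinmx0 eqxx.
  have := mxrank_sum_cap V (kermx a^T); have := rank_leq_col (V + kermx a^T)%MS.
  suff : (\rank (kermx a^T) < \rank (V + kermx a^T)%MS)%N by lia.
  by rewrite (ltn_leqif (mxrank_leqif_sup (addsmxSr _ _))) addsmx_sub negb_and aV.
have fP a : a \in ann K :\: ann V -> f a \in hyperplanes K V.
  rewrite inE => /andP[aV aK]; rewrite inE genmx_id eqxx !genmxE capmxSl rank_f // eqxx !andbT.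
  by rewrite sub_capmx KV -mem_ann.
(* The fibre of [f] over U consists of the forms that vanish on U but not on V: the hyperplane they
   cut out in V contains U and has the same rank. *)
have cnt : (\sum_(U in hyperplanes K V) #|ann U :\: ann V| = #|ann K :\: ann V|)%N.
  rewrite -[RHS]sum1_card (partition_big f (mem (hyperplanes K V))) //=.
  apply: eq_bigr => U; rewrite inE => /and4P[/eqP Ug KU UV rU].
  rewrite -sum1_card; apply: eq_bigl => a; rewrite !inE -!mem_rowg.
  case aV: (a \in ann V) => //=.
  have rfa := rank_f a (negbT aV).
  apply/idP/andP => [aU|[_ /eqP <-]]; last by rewrite mem_ann genmxE capmxSr.
  split; first exact: (subsetP (annS _ _ KU)).
  have sub : (U <= V :&: kermx a^T)%MS by rewrite sub_capmx UV -mem_ann.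
  rewrite -Ug; apply/eqP/genmxP; rewrite andbC -(geq_leqif (mxrank_leqif_eq sub)).
  by move/eqP: rU; rewrite -rfa => -[->].
have cardD (A : 'M[F]_n) : (A <= V)%MS -> #|ann A :\: ann V| = (#|F| ^ (n - \rank A) - #|F| ^ (n - \rank V))%N.
  by move=> AV; rewrite cardsD (setIidPr (annS _ _ AV)) !card_ann.
(* Every fibre has q^(n - rank V) (q - 1) elements. *)
have e : (#|hyperplanes K V| * (#|F| ^ (n - \rank V) * (#|F|.-1)) =
          #|F| ^ (n - \rank V) * (#|F| ^ (\rank V - \rank K)).-1)%N.
  have -> : (#|F| ^ (n - \rank V) * (#|F| ^ (\rank V - \rank K)).-1)%N = #|ann K :\: ann V|.
    rewrite cardD // -subn1 mulnBr muln1 -expnD; congr (_ ^ _ - _)%N; lia.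
  rewrite -cnt -sum_nat_const; apply: eq_bigr => U; rewrite inE => /and4P[_ _ UV /eqP rU].
  rewrite cardD // -subn1 mulnBr muln1 -expnSr; congr (_ ^ _ - _)%N; lia.
have q_gt0 : (0 < #|F| ^ (n - \rank V))%N by rewrite expn_gt0 ltnW.
move/eqP: e; rewrite mulnCA eqn_pmul2l // predn_exp mulnC eqn_pmul2l; first by move/eqP.
by rewrite -subn1 subn_gt0.
Qed.
End Hyperplanes.

(** Position of V and V' with V_1 of dimension d - 1, V'_1 maximal isotropic and their intersection
    of dimension d - 1 - h. For h = 0 this is the orbit E. *)
Definition Gmx (d h : nat) : 'M[nat]_3 :=
  \matrix_(i < 3, j < 3)
    (if i == 1 then 1%N else if j == 1 then 0%N
     else if i == j then (d.-1 - h)%N else h).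

(** The diagonal pairs V = V' with V_1 of dimension i. The corresponding basis elements are
    orthogonal idempotents, and i = d gives j_d. *)
Definition Dmx (d i : nat) : 'M[nat]_3 :=
  \matrix_(r < 3, s < 3)
    (if r != s then 0%N else if r == 1 then (d.*2.+1 - i.*2)%N else i).

Lemma Gmx_Xi d h : (h < d)%N -> in_Xi d (Gmx d h).
Proof. by move=> hd; apply/XiP; rewrite !mxE /=; split=> //; lia. Qed.

Lemma Gmx_dims d h : (h < d)%N ->
  [/\ rdim (Gmx d h) 0 = d.-1, cdim (Gmx d h) 0 = d & Gmx d h 0 0 = (d.-1 - h)%N].
Proof. by move=> hd; rewrite rdimE cdimE !mxE /=; split=> //; lia. Qed.

Lemma GmxT_Xi d : (0 < d)%N -> in_Xi d (Gmx d 0)^T.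
Proof. by move=> hd; apply/XiP; rewrite !mxE /=; split=> //; lia. Qed.

Lemma GmxT_dims d : (0 < d)%N ->
  [/\ rdim (Gmx d 0)^T 0 = d, cdim (Gmx d 0)^T 0 = d.-1 & (Gmx d 0)^T 0 0 = d.-1].
Proof. by move=> hd; rewrite rdimE cdimE !mxE /=; split=> //; lia. Qed.

Lemma Aab_Xi a b : in_Xi (a + b) (Aab a b).
Proof. by apply/XiP; rewrite !mxE /=; split=> //; lia. Qed.

Lemma Aab_dims a b :
  [/\ rdim (Aab a b) 0 = (a + b)%N, cdim (Aab a b) 0 = (a + b)%N & Aab a b 0 0 = a].
Proof. by rewrite rdimE cdimE !mxE /=; split=> //; lia. Qed.

Lemma Dmx_Xi d i : (i <= d)%N -> in_Xi d (Dmx d i).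
Proof. by move=> hd; apply/XiP; rewrite !mxE /=; split=> //; lia. Qed.

Lemma Dmx_dims d i : rdim (Dmx d i) 0 = i /\ cdim (Dmx d i) 0 = i.
Proof. by rewrite rdimE cdimE !mxE /=; split; lia. Qed.

Section FlagCounts.
Variables (F : finFieldType) (d : nat) (J : 'M[F]_(d.*2.+1)).
Hypotheses (Jsym : J^T = J) (Junit : J \in unitmx).
Implicit Types V W : flag J.

Lemma relpos_eq_Dmx V W i :
  (relpos V W == Dmx d i) = (V == W) && (\rank (val V) == i).
Proof.
apply/eqP/andP => [e|[/eqP <- /eqP ri]].
  rewrite -relpos_diag e; split.
    by apply/forallP=> r; apply/forallP=> s; apply/implyP=> /negbTE rs; rewrite mxE rs.
  by have [<- _ _] := relpos_dims V W; rewrite e (Dmx_dims d i).1.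
have Xi1 := relpos_in_Xi Jsym Junit V V.
have off r s : r != s -> relpos V V r s = 0%N.
  by have := relpos_diag V V; rewrite eqxx => /forallP/(_ r)/forallP/(_ s)/implyP h /h /eqP.
have [r0 _ _] := relpos_dims V V.
have id : (i <= d)%N by rewrite -ri; apply: flag_rank_le.
move: r0; rewrite rdimE (off 0 1) // (off 0 2) // ri => r0.
apply: (Xi_eq Xi1 (Dmx_Xi id)); rewrite [RHS]mxE; first by rewrite /=; lia.
- exact: off.
- exact: off.
- exact: off.
Qed.

Lemma card_set1_if (T : finType) (x : T) (P : pred T) (c : bool) :
  (forall y, P y = (y == x) && c) -> #|[set y | P y]| = c.
Proof.
move=> h; have -> : [set y | P y] = if c then [set x] else set0.
  by apply/setP => y; rewrite inE h; case: c {h} => /=; rewrite ?inE ?andbT ?andbF.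
by case: c {h}; rewrite ?cards1 ?cards0.
Qed.

Lemma orbit_count_Dmxl V V' i C :
  orbit_count (Dmx d i) C V V' = (relpos V V' == C) && (rdim C 0 == i) :> nat.
Proof.
apply: (card_set1_if (x := V)) => W; rewrite relpos_eq_Dmx eq_sym -andbA.
case: eqP => //= ->; rewrite andbC; case: eqP => //= <-.
by have [-> _ _] := relpos_dims V V'.
Qed.

Lemma orbit_count_Dmxr V V' i C :
  orbit_count C (Dmx d i) V V' = (relpos V V' == C) && (cdim C 0 == i) :> nat.
Proof.
apply: (card_set1_if (x := V')) => W; rewrite relpos_eq_Dmx andbCA.
case: eqP => //= ->; case: eqP => //= <-.
by have [_ -> _] := relpos_dims V V'.
Qed.

Lemma isotropic_sub (U W : 'M[F]_(d.*2.+1)) :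
  (U <= W)%MS -> (W <= perp J W)%MS -> (U <= perp J U)%MS.
Proof. by move=> UW WW; apply: submx_trans (perpS Jsym UW); apply: submx_trans WW. Qed.

(** A hyperplane U of V_1 is isotropic, hence a flag. Put K = V_1 :&: V'_1, of dimension d - c. Then
    U :&: V'_1 = U :&: K has dimension d - c or d - c - 1 according as U contains K or not, which
    means h = c - 1 or h = c. There are [c]_q hyperplanes containing K, and [d]_q - [c]_q = q^c
    [d - c]_q others. *)
Lemma orbit_count_hyperplane V V' c h : (h < d)%N -> (c <= d)%N ->
  relpos V V' = Aab (d - c) c ->
  orbit_count (Gmx d 0)^T (Gmx d h) V V' =
    ((c == h.+1) * (\sum_(i < c) #|F| ^ i) +
     (c == h) * (#|F| ^ c * \sum_(i < d - c) #|F| ^ i))%N.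
Proof.
move=> hd cd rVV'.
have [rV rV' rVI] := relpos_dims V V'; have [a1 a2 a3] := Aab_dims (d - c) c.
move: rV rV' rVI; rewrite rVV' a1 a2 a3 subnK // => /esym rV /esym rV' /esym rVI {a1 a2 a3}.
set K := (val V :&: val V')%MS in rVI.
have d0 : (0 < d)%N by apply: leq_ltn_trans hd.
have [g1 g2 g3] := Gmx_dims hd; have [f1 f2 f3] := GmxT_dims d0.
have KV : (K <= val V)%MS by apply: capmxSl.
have cap_hyp U : U \in hyperplanes 0 (val V) ->
    \rank (U :&: val V')%MS = (d - c - ~~ (K <= U)%MS)%N.
  rewrite inE => /and4P[_ _ UV /eqP rU].
  have e : \rank (U :&: val V')%MS = \rank (U :&: K)%MS.
    by apply: eqmx_rank; rewrite /K capmxA; apply/andP; split; apply: capmxS => //; rewrite ?capmxSl // sub_capmx submx_refl.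
  rewrite e; have := mxrank_sum_cap U K.
  have sub : (U + K <= val V)%MS by rewrite addsmx_sub UV.
  have := mxrankS sub.
  case KU: (K <= U)%MS.
    by move/capmx_idPr: KU => ->; rewrite rVI subn0.
  have : (\rank U < \rank (U + K)%MS)%N.
    by rewrite (ltn_leqif (mxrank_leqif_sup (addsmxSl _ _))) addsmx_sub submx_refl KU.
  by rewrite subn1; lia.
pose H := [set U in hyperplanes 0 (val V) | (d - c - ~~ (K <= U)%MS == d.-1 - h)%N].
have -> : orbit_count (Gmx d 0)^T (Gmx d h) V V' = #|H|.
  rewrite /orbit_count -(card_imset _ val_inj); congr #|pred_of_set _|; apply/setP => U.
  apply/imsetP/idP => [[W]|].
    rewrite inE (relpos_eq_max Jsym Junit) ?GmxT_Xi ?f1 ?eqxx ?orbT //.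
    rewrite (relpos_eq_max Jsym Junit) ?Gmx_Xi ?g2 ?eqxx //.
    rewrite f2 f3 g1 g3 => /andP[/and3P[_ /eqP rW /eqP cW] /and3P[_ _ /eqP cW']] ->.
    have hyp : val W \in hyperplanes 0 (val V).
      have /andP[gW _] := valP W.
      by rewrite inE gW sub0mx sub_rankE capmxC cW rW rV prednK ?eqxx.
    by rewrite inE hyp -cap_hyp // cW' eqxx.
  rewrite inE => /andP[hyp]; rewrite -cap_hyp // => /eqP cU.
  move: hyp; rewrite inE => /and4P[gU _ UV /eqP rU].
  have /andP[_ iV] := valP V.
  have iU : (<<U>>%MS == U) && (U <= perp J U)%MS by rewrite gU (isotropic_sub UV).
  exists (Sub U iU : flag J) => //; rewrite inE.
  rewrite (relpos_eq_max Jsym Junit) ?GmxT_Xi ?f1 ?eqxx ?orbT //.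
  rewrite (relpos_eq_max Jsym Junit) ?Gmx_Xi ?g2 ?eqxx // SubK.
  rewrite f2 f3 g1 g3 rV rV' cU !eqxx capmxC (capmx_idPl UV).
  by rewrite (_ : \rank U = d.-1) ?eqxx //; lia.
have Hle : hyperplanes K (val V) \subset hyperplanes 0 (val V).
  by apply/subsetP=> U; rewrite !inE sub0mx => /and4P[-> _ -> ->].
have HK U : U \in hyperplanes 0 (val V) -> (K <= U)%MS = (U \in hyperplanes K (val V)).
  by rewrite !inE sub0mx /= => /and3P[-> -> ->]; rewrite /= !andbT.
have c1 := card_hyperplanes KV; have c0 := card_hyperplanes (sub0mx _ (val V)).
move: c1 c0; rewrite rV rVI mxrank0 subn0 => c1 c0.
have dc : (d - (d - c) = c)%N by lia.
rewrite dc in c1.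
have [ch|ch] := eqVneq c h.+1.
  have -> : (c == h) = false by lia.
  rewrite mul1n mul0n addn0 -c1; congr #|pred_of_set _|; apply/setP => U.
  rewrite inE; case hU: (U \in hyperplanes 0 (val V)); last first.
    by symmetry; apply: contraFF hU => /(subsetP Hle).
  (* For d = c, truncated subtraction would let a hyperplane not containing K pass the test; but
     then K = 0 lies in every U. *)
  have K0 : ~~ (K <= U)%MS -> (0 < d - c)%N.
    by apply: contraNltn; rewrite leqn0 -rVI mxrank_eq0 => /eqP ->; exact: sub0mx.
  by rewrite -HK //; case: (K <= U)%MS K0 => /= K0; lia.
rewrite mul0n add0n; have [ch'|ch'] := eqVneq c h.
  have -> : H = hyperplanes 0 (val V) :\: hyperplanes K (val V).
    apply/setP => U; rewrite in_setD [LHS]inE andbC.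
    case hU: (U \in hyperplanes 0 (val V)); last by rewrite !andbF.
    by rewrite -HK //; case: (K <= U)%MS => /=; lia.
  rewrite cardsD (setIidPr Hle) c0 c1 mul1n.
  have [k ->] : exists k, d = (c + k)%N by exists (d - c)%N; rewrite subnKC.
  rewrite addKn big_split_ord /= addKn big_distrr.
  by apply: eq_bigr => i _; rewrite expnD.
rewrite mul0n; apply: eq_card0 => U; rewrite inE.
by rewrite [RHS]inE; case: (U \in _) => //=; case: (K <= U)%MS => /=; lia.
Qed.
End FlagCounts.

(** * Counting maximal isotropic subspaces *)

Lemma rank_adds_row (F : fieldType) m n (A : 'M[F]_(m, n)) (u : 'rV[F]_n) :
  ~~ (u <= A)%MS -> \rank (A + u)%MS = (\rank A).+1.
Proof.
move=> uA; apply/eqP; rewrite eqn_leq; apply/andP; split.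
  by apply: leq_trans (mxrank_adds_leqif A u) _; have := rank_leq_row u; lia.
by rewrite (ltn_leqif (mxrank_leqif_sup (addsmxSl _ _))) addsmx_sub submx_refl.
Qed.

Section Bilinear.
Variables (F : finFieldType) (n : nat) (J : 'M[F]_n).
Hypothesis Jsym : J^T = J.
Implicit Types u w : 'rV[F]_n.

Definition bil u w : F := (u *m J *m w^T) 0 0.

Lemma bilC u w : bil u w = bil w u.
Proof.
have -> : bil u w = ((u *m J *m w^T)^T) 0 0 by rewrite mxE.
by rewrite !trmx_mul trmxK Jsym mulmxA.
Qed.

Lemma bilDl u1 u2 w : bil (u1 + u2) w = bil u1 w + bil u2 w.
Proof. by rewrite /bil !mulmxDl mxE. Qed.

Lemma bilZl a u w : bil (a *: u) w = a * bil u w.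
Proof. by rewrite /bil -!scalemxAl mxE. Qed.

Lemma bilDr u w1 w2 : bil u (w1 + w2) = bil u w1 + bil u w2.
Proof. by rewrite bilC bilDl !(bilC u). Qed.

Lemma bilZr a u w : bil u (a *: w) = a * bil u w.
Proof. by rewrite bilC bilZl (bilC u). Qed.

Definition bilE := (bilDl, bilDr, bilZl, bilZr).

Lemma perp_rowP m (A : 'M[F]_(m, n)) (U : 'M[F]_n) :
  reflect (forall a u, (a <= A)%MS -> (u <= U)%MS -> bil a u = 0) (A <= perp J U)%MS.
Proof.
apply: (iffP idP) => [AU a u aA uU|h].
  have := submx_trans aA AU; case/submxP: uU => B ->.
  rewrite sub_perp /bil trmx_mul mulmxA => /eqP ->; by rewrite mul0mx mxE.
rewrite sub_perp; apply/eqP/matrixP => i j.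
rewrite [RHS]mxE -(h (row i A) (row j U)) ?row_sub // /bil -!row_mul !mxE.
by apply: eq_bigr => k _; rewrite !mxE.
Qed.

Lemma rV_perp (u : 'rV[F]_n) (U : 'M[F]_n) :
  reflect (forall w, (w <= U)%MS -> bil u w = 0) (u <= perp J U)%MS.
Proof.
apply: (iffP (perp_rowP _ _)) => [h w|h a w]; first exact: h.
by case/sub_rVP => c -> wU; rewrite bilZl h // mulr0.
Qed.

End Bilinear.

Lemma sub_adds_rowP (F : fieldType) m n (A : 'M[F]_(m, n)) (l v : 'rV[F]_n) :
  reflect (exists u s, (u <= A)%MS /\ v = u + s *: l) (v <= A + l)%MS.
Proof.
apply: (iffP sub_addsmxP) => [[[u w] /= ->]|[u [s [/submxP[B ->] ->]]]].
  exists (u *m A), (w 0 0); split; first exact: submxMl.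
  by rewrite -mul_scalar_mx -mx11_scalar.
by exists (B, s%:M); rewrite /= mul_scalar_mx.
Qed.

Section Cone.
Variables (F : finFieldType) (d : nat) (J : 'M[F]_(d.*2.+1)).
Hypotheses (Jsym : J^T = J) (Junit : J \in unitmx) (two_neq0 : 2%:R != 0 :> F).
Variables (U V' : flag J) (h : nat) (hd : (h < d)%N).
Hypothesis rUV' : relpos U V' = Gmx d h.
Variables x y z : 'rV[F]_(d.*2.+1).
Hypotheses (xU : (x <= perp J (val U))%MS) (yU : (y <= perp J (val U))%MS)
  (zU : (z <= perp J (val U))%MS) (xV' : (x <= val V')%MS).
Local Notation bil := (bil J).
Hypotheses (xx : bil x x = 0) (xy : bil x y = 0) (xz : bil x z = 1)
  (yy : bil y y = 1) (yz : bil y z = 0) (zz : bil z z = 0).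

Let yx : bil y x = 0. Proof. by rewrite bilC. Qed.
Let zx : bil z x = 1. Proof. by rewrite bilC. Qed.
Let zy : bil z y = 0. Proof. by rewrite bilC. Qed.
Let gram := (xx, xy, xz, yx, yy, yz, zx, zy, zz).

(** Points of the conic 2 a c + b^2 = 0 of isotropic lines in the three-dimensional quotient of
    U^perp by U, where a, b, c are the coordinates along x, y, z. [None] is the special point x,
    which lies in V'; the other points are normalized by c = 1. *)
Definition iso_vec (o : option F) :=
  if o is Some s then z + s *: y + (- (s ^+ 2 / 2%:R)) *: x else x.

Let rU : \rank (val U) = d.-1.
Proof. by have [<- _ _] := relpos_dims U V'; rewrite rUV'; have [-> _ _] := Gmx_dims hd. Qed.

Let rV' : \rank (val V') = d.
Proof. by have [_ <- _] := relpos_dims U V'; rewrite rUV'; have [_ -> _] := Gmx_dims hd. Qed.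

Let rUVI : \rank (val U :&: val V')%MS = (d.-1 - h)%N.
Proof. by have [_ _ <-] := relpos_dims U V'; rewrite rUV'; have [_ _ ->] := Gmx_dims hd. Qed.

Let d0 : (0 < d)%N. Proof. exact: leq_ltn_trans hd. Qed.

Let bilU u a : (u <= perp J (val U))%MS -> (a <= val U)%MS -> bil u a = 0.
Proof. by move=> /rV_perp; exact. Qed.

Let bilUl u a : (u <= perp J (val U))%MS -> (a <= val U)%MS -> bil a u = 0.
Proof. by move=> uU aU; rewrite bilC // bilU. Qed.

Lemma iso_vec_perp o : (iso_vec o <= perp J (val U))%MS.
Proof. by case: o => [s|] //=; rewrite !addmx_sub ?scalemx_sub. Qed.

Lemma iso_vec_iso o : bil (iso_vec o) (iso_vec o) = 0.
Proof. by case: o => [s|] //=; rewrite !(bilE Jsym) !gram; field. Qed.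

(** Pairing with x separates the special point from the others. As x lies in the isotropic V', it
    also shows that the other flags meet V' only inside U. *)
Lemma bil_iso_vec o : bil (iso_vec o) x = (o != None)%:R.
Proof. by case: o => [s|] /=; rewrite ?(bilE Jsym) !gram; ring. Qed.

Lemma iso_vec_notin o : ~~ (iso_vec o <= val U)%MS.
Proof.
apply/negP => lU; case: o lU => [s|] lU.
  by have := bil_iso_vec (Some s); rewrite bilUl // => /esym/eqP; rewrite oner_eq0.
by have := xz; rewrite bilUl // => /esym/eqP; rewrite oner_eq0.
Qed.

Definition iso_mx o := <<(val U + iso_vec o)%MS>>%MS.

Lemma iso_mx_flag o : (<<iso_mx o>>%MS == iso_mx o) && (iso_mx o <= perp J (iso_mx o))%MS.
Proof.
rewrite /iso_mx genmx_id eqxx /=; apply/perp_rowP => a b; rewrite !genmxE.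
have /andP[_ /perp_rowP isoU] := valP U.
move=> /sub_adds_rowP[u [s [uU ->]]] /sub_adds_rowP[u' [s' [uU' ->]]].
by rewrite !(bilE Jsym) isoU // iso_vec_iso bilUl ?iso_vec_perp // bilU ?iso_vec_perp // !mulr0 !addr0.
Qed.

Definition iso_flag o : flag J := Sub (iso_mx o) (iso_mx_flag o).

Lemma rank_iso_mx o : \rank (iso_mx o) = d.
Proof. by rewrite genmxE rank_adds_row ?iso_vec_notin // rU prednK. Qed.

Lemma iso_flag_inj : injective iso_flag.
Proof.
move=> o o' /(congr1 val) /= e.
have : (iso_vec o' <= iso_mx o)%MS by rewrite e genmxE addsmxSr.
rewrite genmxE => /sub_adds_rowP[u [s [uU el]]].
(* Modulo U, one vector is s times the other. Pairing with x tells the special point from the others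
   or forces s = 1, and pairing with y then compares the parameters. *)
have /= := congr1 (fun w => bil w x) el; have /= := congr1 (fun w => bil w y) el.
rewrite !bilDl !bilZl (bilUl xU uU) (bilUl yU uU) !bil_iso_vec !add0r.
case: o o' el {e} => [b|] [b'|] //= el.
- rewrite ?(bilE Jsym) !gram => hy hx; congr Some.
  have s1 : s = 1 by rewrite -[LHS]mulr1 -hx.
  by move: hy; rewrite s1 !mul1r !mulr1 !mulr0 !addr0 !add0r.
- rewrite xy ?(bilE Jsym) !gram => _ /esym/eqP; rewrite mulr1 => /eqP s0.
  have := iso_vec_notin None; rewrite /= el s0 scale0r addr0.
  by rewrite uU.
- by move=> _ /eqP; rewrite mulr0 oner_eq0.
Qed.

Let rank_top : \rank (val U + x + y + z)%MS = d.+2.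
Proof.
have nz : ~~ (z <= val U + x + y)%MS.
  apply: contra_eqN zx => /sub_adds_rowP[a [s [/sub_adds_rowP[u [s' [uU ->]]] ->]]].
  by rewrite !(bilE Jsym) !gram (bilUl xU uU) !mulr0 !addr0 eq_sym oner_eq0.
have ny : ~~ (y <= val U + x)%MS.
  apply: contra_eqN yy => /sub_adds_rowP[u [s' [uU ey]]].
  by rewrite {1}ey !(bilE Jsym) !gram (bilUl yU uU) !mulr0 !addr0 eq_sym oner_eq0.
have nx := iso_vec_notin None.
by rewrite !rank_adds_row // rU prednK.
Qed.

Let perpU_sub : (perp J (val U) <= val U + x + y + z)%MS.
Proof.
have sub : (val U + x + y + z <= perp J (val U))%MS.
  by rewrite !addsmx_sub xU yU zU !andbT; case/andP: (valP U).
rewrite -(geq_leqif (mxrank_leqif_sup sub)) rank_top rank_perp // rU; move: d0; clear; lia.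
Qed.

Lemma iso_flag_surj (W : flag J) : (val U <= val W)%MS -> \rank (val W) = d ->
  exists o, W = iso_flag o.
Proof.
move=> UW rW.
have /andP[/eqP gW isoW] := valP W.
suff [o lW] : exists o, (iso_vec o <= val W)%MS.
  exists o; apply: val_inj; rewrite -gW SubK /iso_mx; apply/genmxP; rewrite andbC.
  have sub : (val U + iso_vec o <= val W)%MS by rewrite addsmx_sub UW.
  by rewrite -(geq_leqif (mxrank_leqif_eq sub)) rank_adds_row ?iso_vec_notin // rU rW prednK.
have /row_subPn[i] : ~~ (val W <= val U)%MS.
  by apply/negP => /mxrankS; rewrite rU rW leqNgt prednK ?leqnn.
set w := row i _ => wU.
have wW : (w <= val W)%MS by apply: row_sub.
have wp : (w <= perp J (val U))%MS.
  by apply: submx_trans (perpS Jsym UW); apply: submx_trans isoW.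
have ww : bil w w = 0 by move/perp_rowP: isoW; apply.
have /sub_adds_rowP[_ [c [/sub_adds_rowP[_ [b [/sub_adds_rowP[u [a [uU ->]]] ->]]] ew]]] := submx_trans wp perpU_sub.
(* W is U plus the line of w', and the isotropy of w' is the equation of the conic. *)
pose w' := a *: x + b *: y + c *: z.
have ew' : w = u + w' by rewrite ew /w' !addrA.
have w'W : (w' <= val W)%MS.
  by have -> : w' = w - u; [rewrite ew' addrC addKr | rewrite addmx_sub ?eqmx_opp // (submx_trans uU)].
have w'U : ~~ (w' <= val U)%MS by apply: contra wU => w'U; rewrite ew' addmx_sub.
have q0 : 2%:R * a * c + b ^+ 2 = 0.
  have <- : bil w' w' = 2%:R * a * c + b ^+ 2 by rewrite !(bilE Jsym) !gram; ring.
  by move/perp_rowP: isoW; apply.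
(* For c = 0 the equation leaves only the multiples of x; otherwise dividing by c gives the
   parameter b / c. *)
have [c0|c0] := eqVneq c 0.
  have b0 : b = 0.
    by apply/eqP; rewrite -sqrf_eq0; apply/eqP; rewrite -q0 c0 mulr0 add0r.
  move: w'W w'U; rewrite /w' b0 c0 !scale0r !addr0 => axW axU; exists None => /=.
  have a0 : a != 0 by apply: contraNneq axU => ->; rewrite scale0r sub0mx.
  by rewrite -(scale1r x) -(mulVf a0) -scalerA scalemx_sub.
exists (Some (b / c)) => /=.
have -> : z + (b / c) *: y + (- ((b / c) ^+ 2 / 2%:R)) *: x = c^-1 *: w'.
  have -> : - ((b / c) ^+ 2 / 2%:R) = c^-1 * a.
    have b2 : b ^+ 2 = - (2%:R * a * c) by apply/eqP; rewrite -addr_eq0 addrC q0.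
    by rewrite exprMn b2; field; rewrite c0.
  rewrite /w' !scalerDr !scalerA mulVf // scale1r (mulrC b).
  by rewrite -addrA addrC (addrC (_ *: y)).
by rewrite scalemx_sub.
Qed.

Lemma rank_iso_cap o : \rank (iso_mx o :&: val V')%MS = (d - (h + (o != None)))%N.
Proof.
have e0 : \rank (val U :&: (iso_mx o :&: val V'))%MS = (d.-1 - h)%N.
  rewrite capmxA -rUVI; apply: eqmx_rank; apply/eqmxP; apply: cap_eqmx => //; apply/eqmxP.
  by rewrite capmxSl sub_capmx submx_refl genmxE addsmxSl.
case: o e0 => [s|] e0.
  have sub : (iso_mx (Some s) :&: val V' <= val U)%MS.
    apply/rV_subP => w; rewrite sub_capmx genmxE => /andP[/sub_adds_rowP[u [c [uU ew]]] wV].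
    have /andP[_ /perp_rowP isoV] := valP V'.
    have := isoV _ _ wV xV'; rewrite ew bilDl bilZl bil_iso_vec (bilUl xU uU) add0r mulr1 => ->.
    by rewrite scale0r addr0.
  by move: e0; rewrite (capmx_idPr sub) => ->; rewrite /= addn1 -subn1 -subnDA add1n.
(* For the special point, W = U + x with x in V'. So W is the sum of U and W :&: V', and the
   intersection gains one dimension over that of U. *)
have := mxrank_sum_cap (val U) (iso_mx None :&: val V')%MS.
have -> : \rank (val U + (iso_mx None :&: val V'))%MS = d.
  rewrite -[RHS](rank_iso_mx None); apply: eqmx_rank; rewrite addsmx_sub capmxSl genmxE addsmxSl /=.
  by rewrite genmxE addsmxS ?submx_refl // sub_capmx xV' genmxE addsmxSr.
by rewrite e0 rU /= addn0; move: (\rank _) hd; clear; lia.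
Qed.

Lemma orbit_count_cone b : (b <= d)%N ->
  orbit_count (Gmx d 0) (Aab (d - b) b) U V' = ((b == h) + (b == h.+1) * #|F|)%N.
Proof.
move=> bd; have [a1 a2 a3] := Aab_dims (d - b) b; rewrite subnK // in a1 a2.
have [g1 g2 g3] := Gmx_dims d0; rewrite subn0 in g3.
have hA : in_Xi d (Aab (d - b) b) by have := Aab_Xi (d - b) b; rewrite subnK.
have -> : orbit_count (Gmx d 0) (Aab (d - b) b) U V'
    = #|iso_flag @: [set o | (d - (h + (o != None)) == d - b)%N]|.
  congr #|pred_of_set _|; apply/setP => W; rewrite inE.
  rewrite (relpos_eq_max Jsym Junit) ?Gmx_Xi ?g2 ?eqxx // g1 g3.
  rewrite (relpos_eq_max Jsym Junit) // ?a2 ?eqxx // a1 a3 rU rV' !eqxx.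
  apply/idP/imsetP => [/andP[/and3P[_ /eqP rW cUW] /and3P[_ _ cW]]|[o]].
    have [|o eW] := @iso_flag_surj W _ rW; first by rewrite sub_rankE rU.
    by exists o => //; rewrite inE -rank_iso_cap; move: cW; rewrite eW SubK.
  rewrite inE -rank_iso_cap => ho ->; rewrite SubK rank_iso_mx eqxx ho.
  by rewrite -[X in _ == X]rU -sub_rankE genmxE addsmxSl.
rewrite card_imset; last exact: iso_flag_inj.
rewrite (cardsD1 None) inE /= addn0; congr addn; first by move: hd bd; clear; lia.
have -> : [set o | (d - (h + (o != None)) == d - b)%N] :\ None
    = @Some F @: [set s : F | b == h.+1].
  apply/setP => -[s|]; rewrite !inE /= ?addn1.
    by rewrite mem_imset ?inE; [move: hd bd; clear; lia | move=> ? ? []].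
  by apply/esym/imsetP => -[].
rewrite card_imset; last by move=> ? ? [].
have -> : [set s : F | b == h.+1] = if b == h.+1 then setT else set0.
  by apply/setP => s; rewrite inE; case: (b == h.+1); rewrite inE.
by case: (b == h.+1); rewrite ?mul1n ?mul0n ?cardsT ?cards0.
Qed.
End Cone.

(** * Realization of all relative positions *)

Section CoordSpace.
Variables (F : finFieldType) (n : nat).
Implicit Types P Q : pred 'I_n.

Definition coord_rows P : 'M[F]_(#|P|, n) := \matrix_(i, j) (enum_val i == j)%:R.
Definition coord_sp P : 'M[F]_n := <<coord_rows P>>%MS.

Lemma coord_spP m (A : 'M[F]_(m, n)) P :
  reflect (forall i k, ~~ P k -> A i k = 0) (A <= coord_sp P)%MS.
Proof.
rewrite genmxE; apply: (iffP idP) => [/submxP[B ->] i k Pk|h].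
  rewrite mxE big1 // => l _; rewrite mxE; case: eqP => [e|]; last by rewrite mulr0.
  by case/negP: Pk; rewrite -e; exact: enum_valP l.
apply/submxP; exists (A *m (coord_rows P)^T); apply/matrixP => i k; rewrite !mxE.
under eq_bigr => l _ do rewrite !mxE.
have [Pk|Pk] := boolP (P k).
  pose l0 := enum_rank_in Pk k; have e0 : enum_val l0 = k by rewrite enum_rankK_in.
  rewrite (bigD1 l0) //= e0 eqxx mulr1 (bigD1 k) //= !mxE e0 eqxx mulr1 !big1 ?addr0 // => l lk.
    by rewrite -[k in (_ == k)]e0 (inj_eq enum_val_inj) (negbTE lk) mulr0.
  by rewrite !mxE e0 eq_sym (negbTE lk) mulr0.
rewrite h // big1 // => l _; case: eqP => [e|]; last by rewrite mulr0.
by case/negP: Pk; rewrite -e; exact: enum_valP l.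
Qed.

Lemma rank_coord_sp P : \rank (coord_sp P) = #|P|.
Proof.
rewrite genmxE; apply/eqP; rewrite -[_ == _]/(row_free _); apply/row_freeP.
exists (coord_rows P)^T; apply/matrixP => i j; rewrite !mxE (bigD1 (enum_val i)) //= !mxE eqxx mul1r.
rewrite big1 ?addr0 => [|k ki]; last by rewrite !mxE eq_sym (negbTE ki) mul0r.
by rewrite (inj_eq enum_val_inj) eq_sym.
Qed.

Lemma coord_sp_cap P Q : (coord_sp P :&: coord_sp Q :=: coord_sp [predI P & Q])%MS.
Proof.
apply/eqmxP/andP; split.
  apply/coord_spP => i k; rewrite /= negb_and => /orP[]; apply: (coord_spP _ _ _).
    exact: capmxSl.
  exact: capmxSr.
rewrite sub_capmx; apply/andP; split; apply/coord_spP => i k Pk;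
  by apply: (coord_spP _ _ (submx_refl _)); rewrite /= negb_and Pk ?orbT.
Qed.

Lemma coord_sp_eq P Q : P =1 Q -> (coord_sp P :=: coord_sp Q)%MS.
Proof.
move=> PQ; apply/eqmxP/andP; split; apply/coord_spP => i k h;
  by apply: (coord_spP _ _ (submx_refl _)); rewrite ?PQ // -PQ.
Qed.

Variable s : 'S_n.
Hypothesis sK : involutive s.

Lemma perm_mx_sym : (perm_mx s : 'M[F]_n)^T = perm_mx s.
Proof.
rewrite tr_perm_mx; congr perm_mx; apply/permP => k.
by apply: (perm_inj (s := s)); rewrite permKV sK.
Qed.

Lemma bil_perm (u w : 'rV[F]_n) : bil (perm_mx s) u w = \sum_k u 0 (s k) * w 0 k.
Proof.
rewrite /bil mxE; apply: eq_bigr => k _; rewrite [w^T _ _]mxE; congr (_ * _).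
by rewrite -perm_mx_sym tr_perm_mx -col_permE mxE.
Qed.

Lemma bil_perm_delta (u : 'rV[F]_n) k : bil (perm_mx s) u (delta_mx 0 k) = u 0 (s k).
Proof.
rewrite bil_perm (bigD1 k) //= mxE !eqxx mulr1 big1 ?addr0 // => l lk.
by rewrite mxE (negbTE lk) andbF mulr0.
Qed.

(** Under this form the basis vector of index k pairs nontrivially only with that of index s k. *)
Lemma perp_coord_sp P :
  (perp (perm_mx s) (coord_sp P) :=: coord_sp (fun k => ~~ P (s k)))%MS.
Proof.
apply/eqmxP/andP; split; apply/rV_subP => u.
  move=> /rV_perp uP; apply/coord_spP => i k; rewrite negbK ord1 => Psk.
  rewrite -[k in LHS]sK -bil_perm_delta; apply: uP.
  apply/coord_spP => i' l Pl; rewrite mxE ord1 /=; case: eqP => // e.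
  by rewrite e Psk in Pl.
move=> /coord_spP uP; apply/rV_perp => w /coord_spP wP.
rewrite bil_perm big1 // => k _; have [Pk|Pk] := boolP (P k).
  by rewrite uP ?mul0r // sK Pk.
by rewrite [w _ _]wP ?mulr0.
Qed.
End CoordSpace.

(** The coordinates are distributed among the cells of C. The involution s, which will define the
    form, exchanges opposite cells; it fixes the central coordinates one by one, so that their basis
    vectors have norm 1. *)
Lemma Xi_labelling d (C : 'M[nat]_3) : in_Xi d C ->
  exists (s : 'S_(d.*2.+1)) (lab : 'I_(d.*2.+1) -> 'I_3 * 'I_3),
  [/\ involutive s, forall k, lab (s k) = (rev_ord (lab k).1, rev_ord (lab k).2),
      forall k, lab k = (1, 1) -> s k = k
    & forall p, #|[set k | lab k == p]| = C p.1 p.2].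
Proof.
move=> hC; have /andP[/eqP tot /forallP symC] := hC.
have {}symC i j : C i j = C (rev_ord i) (rev_ord j) by have /forallP/(_ j)/eqP := symC i.
(* A coordinate is a cell together with a number below its entry; the involution reverses the cell
   and keeps the number. *)
pose PT := fun t : ('I_3 * 'I_3) * 'I_(d.*2.+2) => (t.2 < C t.1.1 t.1.2)%N.
pose T := {t | PT t}.
have C_le i j : (C i j <= d.*2.+1)%N.
  by have /XiP[e22 e21 e20 e12 e] := hC; elim/I3_ind: i; elim/I3_ind: j; lia.
have fiberT p : #|[set u : T | (val u).1 == p]| = C p.1 p.2.
  have wd (k : 'I_(C p.1 p.2)) : PT (p, inord k).
    by rewrite /PT /= inordK // (leq_trans (ltn_ord k)) // ltnW // ltnS C_le.
  pose f (k : 'I_(C p.1 p.2)) : T := Sub (p, inord k) (wd k).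
  rewrite -[RHS]card_ord -(card_imset (f := f)).
    congr #|pred_of_set _|; apply/setP => u; rewrite inE; apply/eqP/imsetP => [up|[k _ ->]]; last by rewrite SubK.
    have uk : ((val u).2 < C p.1 p.2)%N by rewrite -up; exact: (valP u).
    exists (Ordinal uk) => //; apply: val_inj; rewrite SubK [LHS]surjective_pairing up; congr pair.
    by apply: val_inj; rewrite /= inordK.
  move=> k k' /(congr1 val); rewrite !SubK => -[] /(congr1 val) /=.
  have lt (l : 'I_(C p.1 p.2)) : (l < d.*2.+2)%N.
    by rewrite (leq_trans (ltn_ord l)) // ltnW // ltnS C_le.
  by rewrite !inordK // => /val_inj.
have cardT : #|{: T}| = d.*2.+1.
  rewrite -sum1_card (partition_big (fun u : T => (val u).1) predT) //=.
  rewrite -[RHS]tot pair_big /=; apply: eq_bigr => p _; rewrite -fiberT -sum1_card.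
  by apply: eq_bigl => u; rewrite inE.
pose g (u : T) : 'I_(d.*2.+1) := cast_ord cardT (enum_rank u).
pose g' k : T := enum_val (cast_ord (esym cardT) k).
have gK : cancel g g' by move=> u; rewrite /g /g' cast_ordK enum_rankK.
have g'K : cancel g' g by move=> k; rewrite /g /g' enum_valK cast_ordKV.
have revT (u : T) : PT ((rev_ord (val u).1.1, rev_ord (val u).1.2), (val u).2).
  by rewrite /PT /= -symC; exact: (valP u).
pose r (u : T) : T := Sub _ (revT u).
have rK : involutive r.
  move=> u; apply: val_inj; rewrite !SubK /= !rev_ordK.
  by case: (sval u) => [[]].
pose s0 k := g (r (g' k)).
have s0K : involutive s0 by move=> k; rewrite /s0 gK rK g'K.
exists (perm (can_inj s0K)), (fun k => (val (g' k)).1); split.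
- by move=> k; rewrite !permE.
- by move=> k; rewrite permE /s0 gK SubK.
- move=> k; rewrite permE => e; rewrite /s0 -[RHS]g'K; congr g.
  apply: val_inj; rewrite SubK e !rev1.
  by move: e; case: (val (g' k)) => a b /= ->.
- move=> p; rewrite -fiberT -(card_imset _ (can_inj gK)).
  congr #|pred_of_set _|; apply/setP => k; rewrite inE; apply/idP/imsetP => [e|[u]].
    by exists (g' k); rewrite ?inE ?g'K.
  by rewrite inE => e ->; rewrite gK.
Qed.

(** The i-th step of V is spanned by the coordinates labelled in the first i rows, the j-th step of
    V' by those in the first j columns. For C = [Gmx d h] each cell of the middle row holds one
    coordinate, and these three give the basis x, y, z used for the conic. *)
Lemma Xi_realized (F : finFieldType) d (C : 'M[nat]_3) : in_Xi d C ->
  exists (J : 'M[F]_(d.*2.+1)) (V V' : flag J),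
  [/\ J^T = J, J \in unitmx, relpos V V' = C &
    forall h, (h < d)%N -> C = Gmx d h ->
    exists x y z : 'rV[F]_(d.*2.+1),
    [/\ [/\ (x <= perp J (val V))%MS, (y <= perp J (val V))%MS, (z <= perp J (val V))%MS
          & (x <= val V')%MS],
        [/\ bil J x x = 0, bil J x y = 0 & bil J x z = 1] &
        [/\ bil J y y = 1, bil J y z = 0 & bil J z z = 0]]].
Proof.
move=> hC; have [s [lab [sK labs lab11 cardC]]] := Xi_labelling hC.
pose J : 'M[F]_(d.*2.+1) := perm_mx s.
pose R i k := ((lab k).1 < i)%N; pose Q i k := ((lab k).2 < i)%N.
have iso (P : pred 'I_(d.*2.+1)) : (forall k, P k -> ~~ P (s k)) ->
    (<<coord_sp F P>>%MS == coord_sp F P) && (coord_sp F P <= perp J (coord_sp F P))%MS.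
  move=> h; rewrite genmx_id eqxx perp_coord_sp //; apply/coord_spP => i k.
  rewrite negbK => Ps; apply: (coord_spP _ _ (submx_refl _)).
  by rewrite -[k]sK; exact: h.
have h1 (i : 'I_3) : (i < 1)%N -> ~~ (rev_ord i < 1)%N by elim/I3_ind: i.
have isoR : forall k, R 1%N k -> ~~ R 1%N (s k) by move=> k; rewrite /R labs; exact: h1.
have isoQ : forall k, Q 1%N k -> ~~ Q 1%N (s k) by move=> k; rewrite /Q labs; exact: h1.
pose V : flag J := Sub (coord_sp F (R 1%N)) (iso _ isoR).
pose V' : flag J := Sub (coord_sp F (Q 1%N)) (iso _ isoQ).
have h2 (i : 'I_3) : ~~ (rev_ord i < 1)%N = (i < 2)%N by elim/I3_ind: i.
have Jsym : J^T = J by exact: perm_mx_sym.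
have perpV : (perp J (val V) :=: coord_sp F (R 2%N))%MS.
  rewrite SubK; apply: eqmx_trans (perp_coord_sp _ sK _) _; apply: coord_sp_eq => k.
  by rewrite /R labs h2.
have perpV' : (perp J (val V') :=: coord_sp F (Q 2%N))%MS.
  rewrite SubK; apply: eqmx_trans (perp_coord_sp _ sK _) _; apply: coord_sp_eq => k.
  by rewrite /Q labs h2.
have sp0 P : P =1 pred0 -> ((0 : 'M[F]_(d.*2.+1)) :=: coord_sp F P)%MS.
  move=> P0; apply/eqmxP; rewrite sub0mx /=.
  by rewrite submx0 -mxrank_eq0 rank_coord_sp eq_card0 // => k; rewrite unfold_in P0.
have sp1 P : P =1 predT -> ((1%:M : 'M[F]_(d.*2.+1)) :=: coord_sp F P)%MS.
  by move=> P1; apply/eqmxP; rewrite submx1 andbT; apply/coord_spP => i k; rewrite P1.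
have stepV i : (i <= 3)%N -> (step V i :=: coord_sp F (R i))%MS.
  case: i => [|[|[|[|//]]]] _ /=; [exact: sp0 | exact: eqmx_refl | exact: perpV |].
  by apply: sp1 => k; rewrite /R ltn_ord.
have stepV' i : (i <= 3)%N -> (step V' i :=: coord_sp F (Q i))%MS.
  case: i => [|[|[|[|//]]]] _ /=; [exact: sp0 | exact: eqmx_refl | exact: perpV' |].
  by apply: sp1 => k; rewrite /Q ltn_ord.
have rk i j : (i <= 3)%N -> (j <= 3)%N ->
    \rank (step V i :&: step V' j)%MS = (\sum_k (R i k && Q j k))%N.
  move=> hi hj; rewrite (cap_eqmx (stepV i hi) (stepV' j hj)) coord_sp_cap rank_coord_sp.
  by rewrite -sum1_card big_mkcond; apply: eq_bigr => k _; rewrite unfold_in /=; case: (_ && _).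
have Jrel : relpos V V' = C.
  apply/matrixP => i j; have := relposE V V' i j.
  have hi := ltn_ord i; have hj := ltn_ord j; have hi' := ltnW hi; have hj' := ltnW hj.
  rewrite !rk // -[C i j](cardC (i, j)).
  have -> : #|[set k | lab k == (i, j)]| = (\sum_k (lab k == (i, j)))%N.
    by rewrite -sum1_card big_mkcond; apply: eq_bigr => k _; rewrite inE; case: (_ == _).
  (* Both sides of the inclusion-exclusion formula [relposE] are sums over coordinates, compared
     term by term. *)
  move=> e; apply/eqP.
  rewrite -(eqn_add2r (\sum_k (R i k && Q j.+1 k))) -(eqn_add2r (\sum_k (R i.+1 k && Q j k))) e.
  rewrite -!big_split /=; apply/eqP/eq_bigr => k _.
  have -> : (lab k == (i, j)) = ((lab k).1 == i :> nat) && ((lab k).2 == j :> nat).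
    by case: (lab k).
  rewrite /R /Q; case: (ltngtP (lab k).1 i); case: (ltngtP (lab k).2 j) => *; lia.
exists J, V, V'; split=> //; first exact: unitmx_perm.
move=> h hd eC.
have [kx] : exists k, lab k = (1, 0).
  have /card_gt0P[k] : (0 < #|[set k | lab k == (1, 0)%R]|)%N by rewrite cardC eC mxE.
  by rewrite inE => /eqP; exists k.
have [ky] : exists k, lab k = (1, 1).
  have /card_gt0P[k] : (0 < #|[set k | lab k == (1, 1)%R]|)%N by rewrite cardC eC mxE.
  by rewrite inE => /eqP; exists k.
move=> laby labx.
have labz : lab (s kx) = (1, 2) by rewrite labs labx rev1 rev0.
have sy := lab11 _ laby.
have nxy : (kx == ky) = false by apply/eqP => e; move: labx; rewrite e laby.
have nyz : (ky == s kx) = false by apply/eqP => e; move: labz; rewrite -e laby.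
have nxz : (kx == s kx) = false by apply/eqP => e; move: labz; rewrite -e labx.
have delta_sub k (P : pred 'I_(d.*2.+1)) : P k -> ((delta_mx 0 k : 'rV[F]_(d.*2.+1)) <= coord_sp F P)%MS.
  move=> Pk; apply/coord_spP => i l Pl; rewrite mxE ord1 /=; case: eqP => // e.
  by rewrite e Pk in Pl.
exists (delta_mx 0 kx), (delta_mx 0 ky), (delta_mx 0 (s kx)).
rewrite !perpV !bil_perm_delta // !mxE /= !sK sy.
have symb (a b : 'I_(d.*2.+1)) := eq_sym a b.
split; split; rewrite ?delta_sub ?/R ?/Q ?labx ?laby ?labz //.
all: by rewrite ?eqxx ?nxy ?nyz ?nxz ?(symb ky kx) ?(symb (s kx) _) ?nxy ?nyz ?nxz.
Qed.

(** * Structure constants *)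

Lemma odd_primes_seq n : exists s : seq nat, [/\ size s = n, uniq s & all (fun p => prime p && (2 < p)%N) s].
Proof.
elim: n => [|n [s [sz us ps]]]; first by exists [::].
have [p mp pp] := prime_above (\max_(k <- s) k + 2).
exists (p :: s); split; rewrite /= ?sz //.
  rewrite us andbT; apply/negP => ps'.
  have := @leq_bigmax_seq _ s xpredT id p ps' isT; move: mp => /=; lia.
by rewrite ps pp andbT; lia.
Qed.

Lemma poly_eq_odd_primes (P Q : {poly int}) :
  (forall p, prime p -> (2 < p)%N -> P.[p%:Z] = Q.[p%:Z]) -> P = Q.
Proof.
move=> PQ; apply/eqP; rewrite -subr_eq0; apply/negPn/negP => nz.
have [s [sz us ps]] := odd_primes_seq (size (P - Q)).
have := max_poly_roots (rs := [seq p%:Z | p <- s]) nz; rewrite size_map sz ltnn.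
have -> : all (root (P - Q)) [seq p%:Z | p <- s].
  apply/allP => _ /mapP[p /(allP ps)/andP[pp p2] ->].
  by rewrite rootE hornerD hornerN PQ // subrr.
rewrite map_inj_uniq ?us => [h|x y []//].
by have := h isT isT.
Qed.

Section Products.
Variables (d : nat) (S : schurJ d).
Local Notation e := (sj_e S).

Lemma sj_const_eq A B C (P : {poly int}) : in_Xi d A -> in_Xi d B ->
  (forall F : finFieldType, 2%:R != 0 :> F ->
   exists (J : 'M[F]_(d.*2.+1)) (V V' : flag J),
   [/\ J^T = J, J \in unitmx, relpos V V' = C & (orbit_count A B V V')%:Z = P.[#|F|%:Z]]) ->
  sj_const S A B C = P.
Proof.
rewrite -!mem_Xi => hA hB h; apply: poly_eq_odd_primes => p pp p2.
have cF : #|'F_p| = p by rewrite card_Fp.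
have two : 2%:R != 0 :> 'F_p.
  have -> : (2%:R == 0 :> 'F_p) = (p %| 2)%N.
    by rewrite (dvdn_pcharf (pchar_Fp pp)).
  by rewrite gtnNdvd.
have [J [V [V' [Jsym Junit <- cnt]]]] := h _ two.
rewrite -[p in _ = P.[p%:Z]]cF -cnt -(@sj_constP _ S _ _ hA hB) ?cF //.
by case: (even_prime pp) p2 => [->|].
Qed.

Definition ev (P : {poly int}) : Qv := (map_poly intr P).[v ^+ 2].

Lemma sj_mul_eq A B (f : 'M[nat]_3 -> {poly int}) : in_Xi d A -> in_Xi d B ->
  (forall C, in_Xi d C -> forall F : finFieldType, 2%:R != 0 :> F ->
   exists (J : 'M[F]_(d.*2.+1)) (V V' : flag J),
   [/\ J^T = J, J \in unitmx, relpos V V' = C & (orbit_count A B V V')%:Z = (f C).[#|F|%:Z]]) ->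
  e A * e B = \sum_(C <- Xi d) ev (f C) *: e C.
Proof.
move=> hA hB h; rewrite sj_mul ?mem_Xi // big_seq [RHS]big_seq; apply: eq_bigr => C.
by rewrite mem_Xi => hC; rewrite (sj_const_eq hA hB (h C hC)).
Qed.

Lemma sum_Xi_delta (V : lmodType Qv) (g : 'M[nat]_3 -> V) A : in_Xi d A ->
  \sum_(C <- Xi d) (C == A)%:R *: g C = g A.
Proof.
move=> hA; rewrite (bigD1_seq A) ?mem_Xi ?Xi_uniq //= eqxx scale1r big1 ?addr0 // => C /negbTE ->.
by rewrite scale0r.
Qed.

Lemma orbit_count_dims (F : finFieldType) (J : 'M[F]_(d.*2.+1)) (V V' : flag J) A B :
  (rdim (relpos V V') 0 != rdim A 0) || (cdim (relpos V V') 0 != cdim B 0) ->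
  orbit_count A B V V' = 0%N.
Proof.
move=> h; apply: eq_card0 => W; rewrite inE; apply/negP => /andP[/eqP eA /eqP eB].
have [a1 a2 _] := relpos_dims V W; have [b1 b2 _] := relpos_dims W V'.
have [c1 c2 _] := relpos_dims V V'.
by move: h; rewrite -eA -eB c1 c2 a1 b2 !eqxx.
Qed.

Lemma ev_nat n : ev n%:R = n%:R.
Proof. by rewrite /ev rmorph_nat -polyC_natr hornerC. Qed.

Lemma evD P Q : ev (P + Q) = ev P + ev Q.
Proof. by rewrite /ev rmorphD hornerD. Qed.

Lemma evM P Q : ev (P * Q) = ev P * ev Q.
Proof. by rewrite /ev rmorphM hornerM. Qed.

Lemma evXn n : ev 'X^n = (v ^+ 2) ^+ n.
Proof. by rewrite /ev map_polyXn hornerXn. Qed.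

Lemma sj_Dmxl i C : (i <= d)%N -> in_Xi d C ->
  e (Dmx d i) * e C = (rdim C 0 == i)%:R *: e C.
Proof.
move=> id hC.
rewrite (@sj_mul_eq _ _ (fun C' => ((C' == C) && (rdim C 0 == i))%:R)) ?Dmx_Xi //; last first.
  move=> C' hC' F two; have [J [V [V' [Js Ju e _]]]] := Xi_realized F hC'.
  by exists J, V, V'; split=> //; rewrite orbit_count_Dmxl // e -polyC_natr hornerC natz.
under eq_bigr => C' _ do rewrite ev_nat -mulnb natrM mulrC -scalerA.
by rewrite -scaler_sumr sum_Xi_delta.
Qed.

Lemma sj_Dmxr i C : (i <= d)%N -> in_Xi d C ->
  e C * e (Dmx d i) = (cdim C 0 == i)%:R *: e C.
Proof.
move=> id hC.
rewrite (@sj_mul_eq _ _ (fun C' => ((C' == C) && (cdim C 0 == i))%:R)) ?Dmx_Xi //; last first.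
  move=> C' hC' F two; have [J [V [V' [Js Ju e _]]]] := Xi_realized F hC'.
  by exists J, V, V'; split=> //; rewrite orbit_count_Dmxr // e -polyC_natr hornerC natz.
under eq_bigr => C' _ do rewrite ev_nat -mulnb natrM mulrC -scalerA.
by rewrite -scaler_sumr sum_Xi_delta.
Qed.

Lemma Xi_AabP C : in_Xi d C -> rdim C 0 = d -> cdim C 0 = d ->
  exists2 c, (c <= d)%N & C = Aab (d - c) c.
Proof.
move=> hC rC cC; have le : (C 0%R 0%R <= d)%N by rewrite -rC rdimE; lia.
exists (d - C 0%R 0%R)%N; first exact: leq_subr.
have [a1 a2 a3] := Aab_dims (d - (d - C 0%R 0%R)) (d - C 0%R 0%R).
have hA := Aab_Xi (d - (d - C 0%R 0%R)) (d - C 0%R 0%R).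
rewrite subnK ?leq_subr // in a1 a2 hA.
by apply/eqP; rewrite (Xi_eq_max hC hA) ?cC ?eqxx // rC a1 a2 a3 subKn // !eqxx.
Qed.

Lemma Xi_GmxP C : in_Xi d C -> rdim C 0 = d.-1 -> cdim C 0 = d -> (0 < d)%N ->
  exists2 h, (h < d)%N & C = Gmx d h.
Proof.
move=> hC rC cC d0; have le : (C 0%R 0%R <= d.-1)%N by rewrite -rC rdimE; lia.
have hd : (d.-1 - C 0%R 0%R < d)%N by lia.
exists (d.-1 - C 0%R 0%R)%N => //.
have [g1 g2 g3] := Gmx_dims hd.
by apply/eqP; rewrite (Xi_eq_max hC (Gmx_Xi hd)) ?cC ?eqxx // rC g1 g2 g3 subKn // !eqxx.
Qed.

Lemma Aab_inj c c' : (c <= d)%N -> (c' <= d)%N ->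
  (Aab (d - c) c == Aab (d - c') c') = (c == c').
Proof.
move=> cd cd'; apply/eqP/eqP => [/matrixP/(_ 0 2)|->//].
by rewrite !mxE.
Qed.

Lemma Gmx_inj h h' : (Gmx d h == Gmx d h') = (h == h').
Proof.
apply/eqP/eqP => [/matrixP/(_ 0 2)|->//].
by rewrite !mxE.
Qed.

Lemma Aab_Xi_le c : (c <= d)%N -> in_Xi d (Aab (d - c) c).
Proof. by move=> cd; have := Aab_Xi (d - c) c; rewrite subnK. Qed.

Lemma Aab_dims_le c : (c <= d)%N ->
  [/\ rdim (Aab (d - c) c) 0 = d, cdim (Aab (d - c) c) 0 = d & Aab (d - c) c 0 0 = (d - c)%N].
Proof. by move=> cd; have := Aab_dims (d - c) c; rewrite subnK. Qed.

Definition gnum (n : nat) : {poly int} := \sum_(i < n) 'X^i.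

Lemma gnum_eval n q : (gnum n).[q%:Z] = (\sum_(i < n) q ^ i)%N%:Z.
Proof.
rewrite horner_sum -[RHS]natz natr_sum; apply: eq_bigr => i _.
by rewrite hornerXn natrX natz.
Qed.

Lemma sj_cone b : (b < d)%N ->
  e (Gmx d 0) * e (Aab (d - b) b) =
  e (Gmx d b) + (0 < b)%:R *: (v ^+ 2 *: e (Gmx d b.-1)).
Proof.
move=> bd; have d0 : (0 < d)%N by apply: leq_ltn_trans bd.
have bd' := ltnW bd; have [a1 a2 a3] := Aab_dims_le bd'; have [g1 g2 g3] := Gmx_dims d0.
(* For b = 0 the predecessor [b.-1] is again 0; the factor 0 < b removes this spurious term. *)
rewrite (@sj_mul_eq _ _ (fun C => (C == Gmx d b)%:R + ((C == Gmx d b.-1) && (0 < b)%N)%:R * 'X)) ?Gmx_Xi ?Aab_Xi_le //; last first.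
  move=> C hC F two; have [J [V [V' [Js Ju e1 cone]]]] := Xi_realized F hC.
  exists J, V, V'; split => //.
  rewrite hornerE hornerMX -!polyC_natr !hornerC.
  have [rc|rc] := boolP ((rdim C 0 == d.-1) && (cdim C 0 == d)).
    case/andP: rc => /eqP rC /eqP cC; have [h hd eC] := Xi_GmxP hC rC cC d0.
    have [x [y [z [[xU yU zU xV'] [xx xy xz] [yy yz zz]]]]] := cone h hd eC.
    rewrite (orbit_count_cone Js Ju two hd (etrans e1 eC) xU yU zU xV' xx xy xz yy yz zz bd').
    rewrite eC !Gmx_inj PoszD PoszM !natz (eq_sym h b); congr (_ + _%:Z * _).
    by case: b {bd bd' a1 a2 a3} => [|b] /=; rewrite ?andbF ?andbT // eqSS eq_sym.
  rewrite orbit_count_dims; last by rewrite e1 g1 a2 -negb_and.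
  have nG h : (h < d)%N -> (C == Gmx d h) = false.
    move=> hd; apply/negP => /eqP eC; move: rc; rewrite eC.
    by have [-> -> _] := Gmx_dims hd; rewrite !eqxx.
  by rewrite !nG ?mul0r //; lia.
rewrite (eq_bigr (fun C => (C == Gmx d b)%:R *: e C + (C == Gmx d b.-1)%:R *: ((0 < b)%:R *: (v ^+ 2 *: e C)))).
  by rewrite big_split /= !sum_Xi_delta ?Gmx_Xi //; lia.
move=> C _; rewrite evD evM !ev_nat -['X]expr1 evXn expr1 scalerDl; congr (_ + _).
by rewrite -mulnb natrM -!scalerA.
Qed.

Lemma sj_hyperplane h : (h < d)%N ->
  e (Gmx d 0)^T * e (Gmx d h) =
  ev (gnum h.+1) *: e (Aab (d - h.+1) h.+1) + (v ^+ 2) ^+ h *: (ev (gnum (d - h)) *: e (Aab (d - h) h)).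
Proof.
move=> hd; have d0 : (0 < d)%N by apply: leq_ltn_trans hd.
have hd' := ltnW hd; have [g1 g2 g3] := Gmx_dims hd; have [f1 f2 f3] := GmxT_dims d0.
rewrite (@sj_mul_eq _ _ (fun C => (C == Aab (d - h.+1) h.+1)%:R * gnum h.+1
    + (C == Aab (d - h) h)%:R * ('X^h * gnum (d - h)))) ?Gmx_Xi ?GmxT_Xi //; last first.
  move=> C hC F two; have [J [V [V' [Js Ju e1 _]]]] := Xi_realized F hC.
  exists J, V, V'; split => //.
  rewrite hornerD !hornerM hornerXn -!polyC_natr !hornerC !gnum_eval.
  have [rc|rc] := boolP ((rdim C 0 == d) && (cdim C 0 == d)).
    case/andP: rc => /eqP rC /eqP cC; have [c cd eC] := Xi_AabP hC rC cC.
    rewrite (orbit_count_hyperplane Js Ju hd cd (etrans e1 eC)).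
    rewrite eC !Aab_inj // PoszD !PoszM !natz; congr (_ + _).
      by case: eqP => [->|]; rewrite ?mul0r.
    by case: eqP => [->|]; rewrite ?mul0r // !mul1r -natz natrX natz.
  rewrite orbit_count_dims; last by rewrite e1 f1 g2 -negb_and.
  have nA c : (c <= d)%N -> (C == Aab (d - c) c) = false.
    move=> cd; apply/negP => /eqP eC; move: rc; rewrite eC.
    by have [-> -> _] := Aab_dims_le cd; rewrite !eqxx.
  by rewrite !nA // !mul0r.
rewrite (eq_bigr (fun C => (C == Aab (d - h.+1) h.+1)%:R *: (ev (gnum h.+1) *: e C) +
   (C == Aab (d - h) h)%:R *: ((v ^+ 2) ^+ h *: (ev (gnum (d - h)) *: e C)))).
  by rewrite big_split /= !sum_Xi_delta ?Aab_Xi_le.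
move=> C _; by rewrite evD !evM !ev_nat evXn scalerDl -!scalerA.
Qed.

End Products.

(** * Scalar identities *)

Section FieldIdentities.
Variable K : fieldType.
Implicit Types V P A X S R u : K.

(** The recursion for [canon_coef] with V = v, P = v^b, A = v^(a+1) and X = v^k, after division by a
    common power of v. The arguments h are the Gauss binomials: h0, h1, h2 those of B_b at k, k + 1,
    k + 2, h2' that of B_(b+1) at k + 2, and h0' that of B_(b-1) at k, with its parity factor. *)
Definition rec_coef V P A X (h0 h1 h2 h2' h0' : K) : Prop :=
  h2 / (A ^+ 2 * X ^+ 2 * V ^+ 3) * ((P / (X * V) - X * V / P) / (V - V^-1))
  + h1 / (A * X * V) * (P / (X ^+ 2 * V ^+ 2 * A))
  + h0 * (P / (X ^+ 2 * V * A) * ((A * X * V - (A * X * V)^-1) / (V - V^-1)))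
  = (P * V - (P * V)^-1) / (V - V^-1) * (h2' / (A ^+ 2 * X * V))
    + h0' / X * ((P - P^-1) / (V - V^-1)).

Lemma sub_inv_neq0 V : V != 0 -> V ^+ 2 - 1 != 0 -> V - V^-1 != 0.
Proof.
move=> V0; apply: contra_neq => /eqP; rewrite subr_eq0 => /eqP e.
by rewrite expr2 {2}e mulfV // subrr.
Qed.

Variables (V P S R u : K).
Hypotheses (V0 : V != 0) (P0 : P != 0) (S0 : S != 0) (R0 : R != 0).
Hypotheses (V1 : V ^+ 2 - 1 != 0) (RV : 1 - R ^+ 4 * V ^+ 4 != 0).

(** In the suffixes of the four cases, the letters are the parities of a + 1 and of k; S = v^s with
    s = ceil(a/2), and R = v^r with r = floor(k/2). All binomials are expressed through u. For a + 1
    even, u is [gbin s r] and w is [gbin s r.+1]. *)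
Let w := u * (1 - S ^+ 4 * R ^+ 4 * V ^+ 4) / (1 - R ^+ 4 * V ^+ 4).

Lemma rec_coef_ee : rec_coef V P (S ^+ 2) (R ^+ 2) u u w w 0.
Proof.
rewrite /rec_coef /w; field.
by rewrite exprMn V0 P0 S0 R0 V1 RV.
Qed.

Lemma rec_coef_eo : rec_coef V P (S ^+ 2) (R ^+ 2 * V) u w w w 0.
Proof.
rewrite /rec_coef /w; field.
by rewrite exprMn V0 P0 S0 R0 V1 RV.
Qed.

(** For a + 1 odd, u is [gbin s.+1 r], while x and y are [gbin s.+1 r.+1] and [gbin s r.+1]. *)
Let x := u * (1 - S ^+ 4 * R ^+ 4 * V ^+ 8) / (1 - R ^+ 4 * V ^+ 4).
Let y := u * (1 - S ^+ 4 * V ^+ 4) / (1 - R ^+ 4 * V ^+ 4).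

Lemma rec_coef_oe : rec_coef V P (S ^+ 2 * V) (R ^+ 2) u u x y u.
Proof.
rewrite /rec_coef /x /y; field.
by rewrite exprMn V0 P0 S0 R0 V1 RV.
Qed.

Lemma rec_coef_oo : rec_coef V P (S ^+ 2 * V) (R ^+ 2 * V) u x x y u.
Proof.
rewrite /rec_coef /x /y; field.
by rewrite exprMn V0 P0 S0 R0 V1 RV.
Qed.


(** Puts back the common factor M^-1, a power of v, and gives the terms the shape that they have in
    [canon_coef_rec]; e is the parity indicator. *)
Lemma rec_coef_scale A X M h0 h1 h2 h2' g e : A != 0 -> X != 0 -> M != 0 ->
  rec_coef V P A X h0 h1 h2 h2' (e * g) ->
  (M * (A ^+ 2 * X ^+ 2 * V ^+ 3))^-1 * h2 * ((P / (X * V) - X * V / P) / (V - V^-1))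
  + (M * (A * X * V))^-1 * h1 * (P ^+ 2 / (X ^+ 2 * V ^+ 2 * A * P))
  + M^-1 * h0 * (P ^+ 2 / (X ^+ 2 * V * A * P) * ((A * (X * V) - (A * (X * V))^-1) / (V - V^-1)))
  = (P * V - (P * V)^-1) / (V - V^-1) * ((M * (A ^+ 2 * X * V))^-1 * h2')
    + e * ((P - P^-1) / (V - V^-1) * ((M * X)^-1 * g)).
Proof.
move=> A0 X0 M0 /(congr1 (fun z => M^-1 * z)) eq_rec.
have V1' : V * V - 1 != 0 by [].
rewrite (_ : _ + e * _ = M^-1 * ((P * V - (P * V)^-1) / (V - V^-1) * (h2' / (A ^+ 2 * X * V))
    + e * g / X * ((P - P^-1) / (V - V^-1)))); last first.
  by field; rewrite V0 P0 A0 X0 M0 V1'.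
rewrite -eq_rec; field.
by rewrite V0 P0 A0 X0 M0 V1'.
Qed.

Lemma gbin_Sr_id (a b c m n : K) : a != 0 -> b != 0 -> n != 0 ->
  c * m / (a * (b * n)) = c / (a * b) * m / n.
Proof. by move=> a0 b0 n0; field; rewrite a0 b0 n0. Qed.

Lemma gbin_pascal_id (c m n z : K) : 1 - m != 0 -> 1 - n != 0 ->
  c * (1 - z) / (1 - n) * (1 - m * n) / (1 - m)
  = c * (1 - z) / (1 - n) + m * (c * (1 - z) / (1 - m)).
Proof. by move=> m0 n0; field; rewrite m0 n0. Qed.

Lemma gbin_SlSr_id (c m n z : K) : m != 0 -> n != 0 -> c * z / n = c * z / m * m / n.
Proof. by move=> m0 n0; field; rewrite m0 n0. Qed.

Lemma rec1_id A : A != 0 ->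
  (A * V)^-1 * ((P - P^-1) / (V - V^-1)) + P ^+ 2 / (A * P)
  = (P * V - (P * V)^-1) / (V - V^-1) * A^-1.
Proof.
move=> A0; have V1' : V * V - 1 != 0 by [].
by field; rewrite V0 P0 A0 V1'.
Qed.

Section RecurrenceCoef.
Variables (D M : K).
Hypotheses (D0 : D != 0) (M0 : M != 0).
Let V1' : V * V - 1 != 0. Proof. by []. Qed.

(** With V = v, D = v^d, M a power of v, and P = v^b (v^(b-1) in [down_id]), the three identities
    produce the coefficients of X_(b+1), X_b and X_(b-1) in t X_b. *)
Lemma up_id : M^-1 * (D / P) * (D^-1 * (((P * V) ^+ 2 - 1) / (V ^+ 2 - 1) * M))
  = (P * V - (P * V)^-1) / (V - V^-1).
Proof. by field; rewrite V0 P0 D0 M0 V1'. Qed.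

Lemma mid_id : M^-1 * (D^-1 * (P ^+ 2 * (((D / P) ^+ 2 - 1) / (V ^+ 2 - 1) * M)))
  + M^-1 * (V ^+ 2 * (D^-1 * ((P ^+ 2 - 1) / (V ^+ 2 - 1) * M))) + (V / D - D / V) / (V - V^-1)
  = P ^+ 2 / D.
Proof. by field; rewrite V0 P0 D0 M0 V1'. Qed.

Lemma down_id :
  M^-1 * (P / D) * (V ^+ 2 * (D^-1 * (P ^+ 2 * (((D / P) ^+ 2 - 1) / (V ^+ 2 - 1) * M))))
  = (P * V) ^+ 2 / (D * V) * ((D / P - (D / P)^-1) / (V - V^-1)).
Proof. by field; rewrite V0 P0 D0 M0 V1'. Qed.
End RecurrenceCoef.

End FieldIdentities.

(** * Gauss binomials in v^4 and the coefficients of the canonical basis *)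

Lemma v_neq0 : v != 0.
Proof. by rewrite /v tofrac_eq0 polyX_eq0. Qed.

Lemma vX_neq1 n : (0 < n)%N -> v ^+ n != 1.
Proof.
move=> n0; rewrite /v -tofracXn -tofrac1 tofrac_eq.
by apply/eqP => /(congr1 (fun p : {poly rat} => size p)); rewrite size_polyXn size_polyC oner_eq0; case: n n0.
Qed.

Lemma v_sub1_neq0 n : (0 < n)%N -> v ^+ n - 1 != 0.
Proof. by move=> n0; rewrite subr_eq0 vX_neq1. Qed.

Lemma v_1sub_neq0 n : (0 < n)%N -> 1 - v ^+ n != 0.
Proof. by move=> n0; rewrite subr_eq0 eq_sym vX_neq1. Qed.

Lemma vX_neq0 n : v ^+ n != 0.
Proof. by rewrite expf_neq0 // v_neq0. Qed.

Definition qf (n : nat) : Qv := \prod_(i < n) (1 - v ^+ (4 * i.+1)).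

Lemma qfS n : qf n.+1 = qf n * (1 - v ^+ (4 * n.+1)).
Proof. by rewrite /qf big_ord_recr. Qed.

Lemma qf_neq0 n : qf n != 0.
Proof. by apply/prodf_neq0 => i _; rewrite v_1sub_neq0. Qed.

(* The Gaussian binomial coefficient [s + r choose r] in the variable v^4. *)
Definition gbin (s r : nat) : Qv := qf (s + r) / (qf s * qf r).

Lemma gbin0r s : gbin s 0 = 1.
Proof. by rewrite /gbin addn0 {3}/qf big_ord0 mulr1 divff ?qf_neq0. Qed.

Lemma gbin0l r : gbin 0 r = 1.
Proof. by rewrite /gbin add0n {2}/qf big_ord0 mul1r divff ?qf_neq0. Qed.

Lemma gbin_Sr s r :
  gbin s r.+1 = gbin s r * (1 - v ^+ (4 * (s + r).+1)) / (1 - v ^+ (4 * r.+1)).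
Proof.
rewrite /gbin addnS !qfS.
exact (gbin_Sr_id _ _ (qf_neq0 s) (qf_neq0 r) (v_1sub_neq0 (isT : 0 < 4 * r.+1)%N)).
Qed.

Lemma gbin_sym s r : gbin s r = gbin r s.
Proof. by rewrite /gbin addnC [qf s * _]mulrC. Qed.

Lemma gbin_Sl s r :
  gbin s.+1 r = gbin s r * (1 - v ^+ (4 * (s + r).+1)) / (1 - v ^+ (4 * s.+1)).
Proof. by rewrite gbin_sym gbin_Sr gbin_sym addnC. Qed.

(** Exhibits [gbin] as a polynomial in v with integer coefficients, which its definition as a
    quotient hides. *)
Lemma gbin_pascal s r : gbin s.+1 r.+1 = gbin s r.+1 + v ^+ (4 * s.+1) * gbin s.+1 r.
Proof.
rewrite (gbin_Sl s r.+1) gbin_Sr (gbin_Sl s r) addnS.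
rewrite (_ : 4 * (s + r).+2 = 4 * s.+1 + 4 * r.+1)%N; last by ring.
by rewrite exprD; exact (gbin_pascal_id _ _ (v_1sub_neq0 (isT : 0 < 4 * s.+1)%N) (v_1sub_neq0 (isT : 0 < 4 * r.+1)%N)).
Qed.

(** The exponent is the difference between the normalizing exponents of X_b and X_(b-k) for a = d -
    b. So, up to one overall power of v, B_b has the bare binomials as coefficients on the e_A:
    polynomials in q^2, as expected of the stalks of an intersection cohomology complex. *)
Definition canon_coef (a k : nat) : Qv :=
  v ^- (a * k + (k * k.+1)./2) * gbin (uphalf a) k./2.

Lemma half_trigS k : ((k.+1 * k.+2)./2 = (k * k.+1)./2 + k.+1)%N.
Proof.
rewrite (_ : k.+1 * k.+2 = k * k.+1 + k.+1.*2)%N; last by rewrite -muln2; ring.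
by rewrite halfD odd_double andbF add0n doubleK.
Qed.

Lemma qintN n : qint (- n) = - qint n.
Proof. by rewrite /qint opprK -mulNr opprB. Qed.

Lemma qintE (n : nat) : qint n = (v ^+ n - (v ^+ n)^-1) / (v - v^-1).
Proof. by rewrite /qint -exprnN. Qed.

Lemma qint_divE (m n : nat) : qint (m%:Z - n%:Z) = (v ^+ m / v ^+ n - v ^+ n / v ^+ m) / (v - v^-1).
Proof. by rewrite /qint opprB !expfzDr ?v_neq0 // -!exprnN. Qed.

Lemma expv_divE (m n : nat) : v ^ (m%:Z - n%:Z) = v ^+ m / v ^+ n.
Proof. by rewrite expfzDr ?v_neq0 // -exprnN. Qed.

Lemma expv_4 (s r : nat) : v ^+ (4 * (s + r).+1) = (v ^+ s) ^+ 4 * (v ^+ r) ^+ 4 * v ^+ 4.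
Proof. by rewrite -!exprM -!exprD; congr (_ ^+ _); ring. Qed.

Lemma canon_coef_rec_scaled a b k :
  let g := gbin (uphalf a.+1) in
  rec_coef v (v ^+ b) (v ^+ a.+1) (v ^+ k) (g k./2) (g (k.+1)./2) (g k.+2./2)
    (gbin (uphalf a) k.+2./2) ((odd a.+1)%:R * gbin (uphalf a.+2) k./2).
Proof.
move=> g; rewrite /g {g}.
have n0 := v_neq0; have b0 := vX_neq0 b.
have V1 : v ^+ 2 - 1 != 0 by rewrite v_sub1_neq0.
have e4 n : 1 - (v ^+ n) ^+ 4 * v ^+ 4 != 0.
  by rewrite -exprM -exprD v_1sub_neq0 // addnS.
have E n : v ^+ (4 * n.+1) = (v ^+ n) ^+ 4 * v ^+ 4.
  by rewrite -exprM -exprD mulnS addnC mulnC.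
have dbl n : v ^+ n.*2 = (v ^+ n) ^+ 2 by rewrite -exprM muln2.
have /orP[/eqP ea|/eqP ea] : (a.+1 == (uphalf a).*2) || (a.+1 == (uphalf a).*2.+1) by lia.
  have -> : odd a.+1 = false by rewrite ea odd_double.
  have -> : uphalf a.+1 = uphalf a by lia.
  rewrite ea dbl mul0r; set s := uphalf a.
  have /orP[/eqP ek|/eqP ek] : (k == k./2.*2) || (k == k./2.*2.+1) by lia.
    have [-> ->] : (k.+1)./2 = k./2 /\ k.+2./2 = (k./2).+1 by lia.
    have -> : v ^+ k = (v ^+ k./2) ^+ 2 by rewrite {1}ek dbl.
    rewrite gbin_Sr expv_4 E; exact (@rec_coef_ee Qv v (v ^+ b) (v ^+ s) (v ^+ k./2) (gbin s k./2) n0 b0 (vX_neq0 s) (vX_neq0 _) V1 (e4 _)).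
  have [-> ->] : (k.+1)./2 = (k./2).+1 /\ k.+2./2 = (k./2).+1 by lia.
  have -> : v ^+ k = (v ^+ k./2) ^+ 2 * v by rewrite {1}ek exprSr dbl.
  rewrite gbin_Sr expv_4 E; exact (@rec_coef_eo Qv v (v ^+ b) (v ^+ s) (v ^+ k./2) (gbin s k./2) n0 b0 (vX_neq0 s) (vX_neq0 _) V1 (e4 _)).
have -> : odd a.+1 by rewrite ea /= odd_double.
have [-> ->] : uphalf a.+1 = (uphalf a).+1 /\ uphalf a.+2 = (uphalf a).+1 by lia.
rewrite ea exprSr dbl mul1r; set s := uphalf a.
set u := gbin s.+1 k./2.
have ey : gbin s (k./2).+1 = u * (1 - (v ^+ s) ^+ 4 * v ^+ 4) / (1 - (v ^+ k./2) ^+ 4 * v ^+ 4).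
  rewrite /u gbin_Sl gbin_Sr !E; exact (gbin_SlSr_id _ _ (e4 s) (e4 k./2)).
have ex : gbin s.+1 (k./2).+1 = u * (1 - (v ^+ s) ^+ 4 * (v ^+ k./2) ^+ 4 * v ^+ 8) / (1 - (v ^+ k./2) ^+ 4 * v ^+ 4).
  rewrite /u gbin_Sr expv_4 E [v ^+ s.+1]exprSr exprMn; congr (_ * (1 - _) / _).
  by rewrite (_ : 8 = 4 + 4)%N // exprD; ring.
have /orP[/eqP ek|/eqP ek] : (k == k./2.*2) || (k == k./2.*2.+1) by lia.
  have [-> ->] : (k.+1)./2 = k./2 /\ k.+2./2 = (k./2).+1 by lia.
  have -> : v ^+ k = (v ^+ k./2) ^+ 2 by rewrite {1}ek dbl.
  rewrite -/u ex ey; exact (@rec_coef_oe Qv v (v ^+ b) (v ^+ s) (v ^+ k./2) u n0 b0 (vX_neq0 s) (vX_neq0 _) V1 (e4 _)).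
have [-> ->] : (k.+1)./2 = (k./2).+1 /\ k.+2./2 = (k./2).+1 by lia.
have -> : v ^+ k = (v ^+ k./2) ^+ 2 * v by rewrite {1}ek exprSr dbl.
rewrite -/u ex ey; exact (@rec_coef_oo Qv v (v ^+ b) (v ^+ s) (v ^+ k./2) u n0 b0 (vX_neq0 s) (vX_neq0 _) V1 (e4 _)).
Qed.

(** Coefficients of X_(b-k-1) in the recursion for t B_b, where d = a + 1 + b. On the left they come
    from the terms X_(b-k-2), X_(b-k-1) and X_(b-k) of B_b, on the right from B_(b+1) and
    B_(b-1). *)
Lemma canon_coef_rec a b k :
  canon_coef a.+1 k.+2 * qint (b%:Z - k.+1%:Z)
  + canon_coef a.+1 k.+1 * v ^ ((b.*2)%:Z - (k.+1.*2 + a.+1 + b)%N%:Z)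
  + canon_coef a.+1 k * (v ^ ((b.*2)%:Z - (k.*2.+1 + a.+1 + b)%N%:Z) * qint (a.+1 + k.+1)%N)
  = qint b.+1 * canon_coef a k.+2 + (odd a.+1)%:R * (qint b * canon_coef a.+2 k).
Proof.
have n0 := v_neq0.
have := canon_coef_rec_scaled a b k; rewrite /canon_coef.
set t := (k * k.+1)./2; set m := (a.+1 * k + t)%N.
have tS : (k.+1 * k.+2)./2 = (t + k.+1)%N by exact: half_trigS.
have tSS : (k.+2 * k.+3)./2 = (t + k.+1 + k.+2)%N by rewrite -tS; exact: half_trigS.
rewrite tSS tS.
have -> : (a.+1 * k.+2 + (t + k.+1 + k.+2) = m + (a.+1 * 2 + k * 2 + 3))%N by rewrite /m; ring.
have -> : (a.+1 * k.+1 + (t + k.+1) = m + (a.+1 + k + 1))%N by rewrite /m; ring.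
have -> : (a * k.+2 + (t + k.+1 + k.+2) = m + (a.+1 * 2 + k + 1))%N by rewrite /m; ring.
have -> : (a.+2 * k + t = m + k)%N by rewrite /m; ring.
rewrite qint_divE !expv_divE !qintE.
have e1 : v ^+ (m + (a.+1 * 2 + k * 2 + 3)) = v ^+ m * ((v ^+ a.+1) ^+ 2 * (v ^+ k) ^+ 2 * v ^+ 3).
  by rewrite !exprD !exprM.
have e2 : v ^+ (m + (a.+1 + k + 1)) = v ^+ m * (v ^+ a.+1 * v ^+ k * v) by rewrite !exprD expr1.
have e3 : v ^+ (m + (a.+1 * 2 + k + 1)) = v ^+ m * ((v ^+ a.+1) ^+ 2 * v ^+ k * v).
  by rewrite !exprD !exprM expr1.
have e4 : v ^+ (k.+1.*2 + a.+1 + b) = (v ^+ k) ^+ 2 * v ^+ 2 * v ^+ a.+1 * v ^+ b.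
  by rewrite -muln2 mulSn addnC addnA -!exprM -!exprD; congr (_ ^+ _); lia.
have e5 : v ^+ (k.*2.+1 + a.+1 + b) = (v ^+ k) ^+ 2 * v * v ^+ a.+1 * v ^+ b.
  by rewrite -!exprM -exprSr -!exprD; congr (_ ^+ _); lia.
rewrite e1 e2 e3 e4 e5 [v ^+ (m + k)]exprD [v ^+ (a.+1 + k.+1)]exprD [v ^+ k.+1]exprSr [v ^+ b.+1]exprSr.
have -> : v ^+ b.*2 = (v ^+ b) ^+ 2 by rewrite -exprM muln2.
exact (rec_coef_scale n0 (vX_neq0 b) (v_sub1_neq0 (isT : 0 < 2)%N) (vX_neq0 a.+1) (vX_neq0 k) (vX_neq0 m)).
Qed.

Lemma canon_coef0 a : canon_coef a 0 = 1.
Proof. by rewrite /canon_coef muln0 /= gbin0r mulr1 invr1. Qed.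

Lemma canon_coef1 a : canon_coef a 1 = v ^- a.+1.
Proof. by rewrite /canon_coef muln1 /= gbin0r mulr1 addn1. Qed.

(** The same comparison for X_b, which does not occur in B_(b-1). *)
Lemma canon_coef_rec1 (a b : nat) :
  canon_coef a.+1 1 * qint b + v ^ ((b.*2)%:Z - (a.+1 + b)%N%:Z) = qint b.+1 * canon_coef a 1.
Proof.
rewrite !canon_coef1 expv_divE !qintE.
have -> : v ^+ b.*2 = (v ^+ b) ^+ 2 by rewrite -exprM muln2.
rewrite exprD [v ^+ a.+2]exprSr [v ^+ b.+1]exprSr.
exact (rec1_id v_neq0 (vX_neq0 b) (v_sub1_neq0 (isT : 0 < 2)%N) (vX_neq0 a.+1)).
Qed.

(** * Membership in v^-1 Z[v^-1] *)

Lemma in_vinvZ0 : in_vinvZ 0.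
Proof. by exists 0; rewrite map_poly0 horner0 mulr0. Qed.

Lemma in_vinvZD c c' : in_vinvZ c -> in_vinvZ c' -> in_vinvZ (c + c').
Proof. by move=> [p ->] [p' ->]; exists (p + p'); rewrite rmorphD hornerD mulrDr. Qed.

Lemma in_vinvZN c : in_vinvZ c -> in_vinvZ (- c).
Proof. by move=> [p ->]; exists (- p); rewrite rmorphN hornerN mulrN. Qed.

Lemma in_vinvZM c c' : in_vinvZ c -> in_vinvZ c' -> in_vinvZ (c * c').
Proof.
move=> [p ->] [p' ->]; exists ('X * p * p').
by rewrite !rmorphM /= map_polyX !hornerM hornerX mulrACA -!mulrA.
Qed.

Lemma in_vinvZ_expN n : (0 < n)%N -> in_vinvZ (v ^- n).
Proof.
by case: n => // n _; exists 'X^n; rewrite map_polyXn hornerXn -exprS exprVn.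
Qed.

(** The bound on n is the degree of [gbin s r] in v; Pascal's rule carries both degree and
    integrality through the induction. *)
Lemma in_vinvZ_gbin s r n : (4 * s * r < n)%N -> in_vinvZ (v ^- n * gbin s r).
Proof.
elim: s r n => [|s IHs] r n; first by rewrite gbin0l mulr1 => h; apply: in_vinvZ_expN; lia.
elim: r n => [|r IHr] n h; first by rewrite gbin0r mulr1; apply: in_vinvZ_expN; lia.
rewrite gbin_pascal mulrDr; apply: in_vinvZD; first by apply: IHs; lia.
have -> : v ^- n * (v ^+ (4 * s.+1) * gbin s.+1 r) = v ^- (n - 4 * s.+1) * gbin s.+1 r.
  rewrite mulrA; congr (_ * _); rewrite -[in LHS](@subnK (4 * s.+1) n); last by lia.
  by rewrite exprD invfM mulfVK // vX_neq0.
by apply: IHr; lia.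
Qed.

(** The degree 4 ceil(a/2) floor(k/2) of the binomial is at most 2 (a + 1) floor(k/2), hence at most
    a k + 2 floor(k/2), and 2 floor(k/2) < k (k + 1) / 2 for k > 0. *)
Lemma in_vinvZ_canon_coef a k : (0 < k)%N -> in_vinvZ (canon_coef a k).
Proof.
move=> k0; apply: in_vinvZ_gbin.
have ua : (4 * uphalf a <= 2 * a.+1)%N by lia.
have : (4 * uphalf a * k./2 <= 2 * a.+1 * k./2)%N by rewrite leq_mul2r ua orbT.
move/leq_ltn_trans; apply.
have -> : (2 * a.+1 * k./2 = a * k./2.*2 + k./2.*2)%N by rewrite -muln2; ring.
have le : (k./2.*2 <= k)%N by lia.
have := leq_mul (leqnn a) le.
suff : (k./2.*2 < (k * k.+1)./2)%N by lia.
case: k k0 {ua le} => [|[|[|k]]] // _.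
rewrite half_trigS half_trigS; lia.
Qed.

(** * Idempotents and diagonal elements *)

Section SchurAlgebra.
Variables (d : nat) (S : schurJ d).
Local Notation e := (sj_e S).

Let basis_tuple := map_tuple e (in_tuple (Xi d)).

Lemma sj_expand (x : S) : exists c : 'M[nat]_3 -> Qv, x = \sum_(C <- Xi d) c C *: e C.
Proof.
have hx := coord_basis (X := basis_tuple) (sj_basis S) (memvf x).
exists (fun C => if insub (index C (Xi d)) is Some i then coord basis_tuple i x else 0).
rewrite {1}hx (big_nth 0) big_mkord; apply: eq_bigr => i _.
by rewrite index_uniq ?Xi_uniq // valK (nth_map 0).
Qed.

Lemma sj_free (c : 'M[nat]_3 -> Qv) :
  \sum_(C <- Xi d) c C *: e C = 0 -> forall C, in_Xi d C -> c C = 0.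
Proof.
rewrite (big_nth 0) big_mkord => h C; rewrite -mem_Xi => hC.
have /freeP fr : free basis_tuple := basis_free (sj_basis S).
have iC : (index C (Xi d) < size (Xi d))%N by rewrite index_mem.
rewrite -(nth_index 0 hC).
apply: (fr (fun i => c (nth 0 (Xi d) i)) _ (Ordinal iC)).
by rewrite -[RHS]h; apply: eq_bigr => i _; rewrite (nth_map 0).
Qed.

Definition sj_coord A (x : S) : Qv :=
  if insub (index A (Xi d)) is Some i then coord basis_tuple i x else 0.

Lemma sj_coordD A x y : sj_coord A (x + y) = sj_coord A x + sj_coord A y.
Proof. by rewrite /sj_coord; case: insub => [i|]; rewrite ?linearD ?addr0. Qed.

Lemma sj_coordZ A a x : sj_coord A (a *: x) = a * sj_coord A x.
Proof. by rewrite /sj_coord; case: insub => [i|]; rewrite ?linearZ ?mulr0. Qed.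

Lemma sj_coord_e A B : in_Xi d A -> in_Xi d B -> sj_coord A (e B) = (A == B)%:R.
Proof.
rewrite -!mem_Xi => hA hB.
have iA : (index A (Xi d) < size (Xi d))%N by rewrite index_mem.
have iB : (index B (Xi d) < size (Xi d))%N by rewrite index_mem.
have fr : free basis_tuple := basis_free (sj_basis S).
rewrite /sj_coord insubT.
have <- : basis_tuple`_(Ordinal iB) = e B by rewrite (nth_map 0) // nth_index.
rewrite coord_free // eq_sym; congr (nat_of_bool _)%:R.
apply/eqP/eqP => [/(congr1 val) /= eAB|eAB]; last by apply: val_inj; rewrite /= eAB.
by rewrite -(nth_index 0 hA) -(nth_index 0 hB) eAB.
Qed.

Lemma sj_eq_left (x y : S) : (forall C, in_Xi d C -> x * e C = y * e C) -> x = y.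
Proof.
move=> xy; rewrite -[x]mulr1 -[y]mulr1; have [c ->] := sj_expand 1.
rewrite !mulr_sumr big_seq [RHS]big_seq; apply: eq_bigr => C; rewrite mem_Xi => hC.
by rewrite -!scalerAr xy.
Qed.

Lemma Aab_d0 : Aab d 0 = Dmx d d.
Proof. by apply/matrixP => i j; rewrite !mxE; elim/I3_ind: i; elim/I3_ind: j => //=; lia. Qed.

Lemma jIE : jI S = e (Dmx d d).
Proof. by rewrite /jI /stdI muln0 /= Aab_d0 invr1 scale1r. Qed.

Lemma jI_mul C : in_Xi d C -> jI S * e C = (rdim C 0 == d)%:R *: e C.
Proof. by rewrite jIE; exact: sj_Dmxl. Qed.

Lemma mul_jI C : in_Xi d C -> e C * jI S = (cdim C 0 == d)%:R *: e C.
Proof. by rewrite jIE; exact: sj_Dmxr. Qed.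

Lemma jI_idem : jI S * jI S = jI S.
Proof.
by rewrite [X in _ * X]jIE jI_mul ?Dmx_Xi // (Dmx_dims d d).1 eqxx scale1r jIE.
Qed.

Definition is_diag (A : 'M[nat]_3) := [forall i, forall j, (i != j) ==> (A i j == 0%N)].

Lemma rdim_le C : in_Xi d C -> (rdim C 0%R <= d)%N.
Proof. by move/XiP=> [_ _ _ _ h]; rewrite rdimE; lia. Qed.

Lemma cdim_le C : in_Xi d C -> (cdim C 0%R <= d)%N.
Proof. by move/XiP=> [_ _ c20 _ h]; rewrite cdimE c20; lia. Qed.

Lemma is_diag_Dmx A : in_Xi d A -> is_diag A -> exists2 i, (i <= d)%N & A = Dmx d i.
Proof.
move=> hA dA; have off i j : i != j -> A i j = 0%N.
  by move: dA => /forallP/(_ i)/forallP/(_ j)/implyP h /h /eqP.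
have le := rdim_le hA; move: le; rewrite rdimE (off 0 1) // (off 0 2) // !addn0 => le.
exists (A 0 0) => //.
move/XiP: hA => [a22 a21 a20 a12].
rewrite (off 0 1) // (off 0 2) // (off 1 0) // => tot.
apply/matrixP => i j; rewrite [RHS]mxE; have [<-|ij] := eqVneq i j; last exact: off.
elim/I3_ind: i => //=; lia.
Qed.

Lemma Dmx_diag i : is_diag (Dmx d i).
Proof.
by apply/forallP => r; apply/forallP => s; apply/implyP => /negbTE rs; rewrite mxE rs.
Qed.

Section DiagAction.
Variable g : 'M[nat]_3 -> Qv.
Hypothesis gP : forall A, ~~ is_diag A -> g A = 0.

Lemma of_coef_diagl C : in_Xi d C ->
  of_coef S g * e C = g (Dmx d (rdim C 0)) *: e C.
Proof.
move=> hC; rewrite mulr_suml -[RHS](sum_Xi_delta (d := d) (fun A => g A *: e C)) ?Dmx_Xi ?rdim_le //.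
rewrite big_seq [RHS]big_seq; apply: eq_bigr => A; rewrite mem_Xi => hA; rewrite -scalerAl.
have [dA|nA] := boolP (is_diag A); last by rewrite gP // !scale0r scaler0.
have [i le eA] := is_diag_Dmx hA dA; subst A.
rewrite sj_Dmxl // scalerA mulrC -scalerA; congr ((nat_of_bool _)%:R *: _).
by apply/eqP/eqP => [->//|/(congr1 (fun A => rdim A 0))]; rewrite !(Dmx_dims _ _).1.
Qed.

Lemma of_coef_diagr C : in_Xi d C ->
  e C * of_coef S g = g (Dmx d (cdim C 0)) *: e C.
Proof.
move=> hC; rewrite mulr_sumr -[RHS](sum_Xi_delta (d := d) (fun A => g A *: e C)) ?Dmx_Xi ?cdim_le //.
rewrite big_seq [RHS]big_seq; apply: eq_bigr => A; rewrite mem_Xi => hA; rewrite -scalerAr.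
have [dA|nA] := boolP (is_diag A); last by rewrite gP // !scale0r scaler0.
have [i le eA] := is_diag_Dmx hA dA; subst A.
rewrite sj_Dmxr // scalerA mulrC -scalerA; congr ((nat_of_bool _)%:R *: _).
by apply/eqP/eqP => [->//|/(congr1 (fun A => cdim A 0))]; rewrite !(Dmx_dims _ _).2.
Qed.
End DiagAction.

Lemma of_coef_unit g : (forall A, ~~ is_diag A -> g A = 0) ->
  (forall i, g (Dmx d i) != 0) -> of_coef S g \is a GRing.unit.
Proof.
move=> g0 gD; pose g' A := (g A)^-1.
have g'0 A : ~~ is_diag A -> g' A = 0 by move=> nA; rewrite /g' g0 // invr0.
apply/unitrP; exists (of_coef S g'); split; apply: sj_eq_left => C hC; rewrite mul1r -mulrA.
  by rewrite of_coef_diagl // -scalerAr of_coef_diagl // scalerA mulfV // scale1r.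
by rewrite of_coef_diagl // -scalerAr of_coef_diagl // scalerA mulVf // scale1r.
Qed.

Lemma dcoef_diag a A : ~~ is_diag A -> dcoef a A = 0.
Proof. by rewrite /dcoef /is_diag => /negbTE ->. Qed.

Lemma dcoef_Dmx a i : dcoef a (Dmx d i) = v ^- cdim (Dmx d i) a.
Proof. by have := Dmx_diag i; rewrite /is_diag /dcoef => ->. Qed.

Lemma dcoef_Dmx_neq0 a i : dcoef a (Dmx d i) != 0.
Proof. by rewrite dcoef_Dmx invr_neq0 // vX_neq0. Qed.

Lemma d1J_unit : d1J S \is a GRing.unit.
Proof. by apply: of_coef_unit => [A|i]; [exact: dcoef_diag | exact: dcoef_Dmx_neq0]. Qed.

Lemma d2J_unit : d2J S \is a GRing.unit.
Proof. by apply: of_coef_unit => [A|i]; [exact: dcoef_diag | exact: dcoef_Dmx_neq0]. Qed.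

Lemma d1J_comm_d2J : d1J S * d2J S = d2J S * d1J S.
Proof.
apply: sj_eq_left => C hC; rewrite -!mulrA !of_coef_diagl; try exact: dcoef_diag; try done.
rewrite -!scalerAr !of_coef_diagl; try exact: dcoef_diag; try done.
by rewrite !scalerA mulrC.
Qed.

Lemma d1J_jI : d1J S * jI S = v ^- d *: jI S.
Proof.
rewrite jIE of_coef_diagl ?Dmx_Xi // => [|A]; last exact: dcoef_diag.
by rewrite dcoef_Dmx (Dmx_dims d d).1 (Dmx_dims d d).2.
Qed.

Lemma jI_d1J : jI S * d1J S = v ^- d *: jI S.
Proof.
rewrite jIE of_coef_diagr ?Dmx_Xi // => [|A]; last exact: dcoef_diag.
by rewrite dcoef_Dmx !(Dmx_dims d d).2.
Qed.

Lemma d2J_jI : d2J S * jI S = v^-1 *: jI S.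
Proof.
rewrite jIE of_coef_diagl ?Dmx_Xi // => [|A]; last exact: dcoef_diag.
rewrite dcoef_Dmx (Dmx_dims d d).1 cdimE !mxE /=; congr (_^-1 *: _).
by rewrite -[RHS]expr1; congr (_ ^+ _); lia.
Qed.

(** Left multiplication by d_1 is diagonal on the e_C, with eigenvalue v^-i for first row sum i;
    these eigenvalues are distinct because v is not a root of unity. The eigenspace for v^-d is the
    image of j_d. *)
Lemma eigen_d1J_l (x : S) : d1J S * x = v ^- d *: x -> jI S * x = x.
Proof.
have [c ->] := sj_expand x => h.
suff c0 C : in_Xi d C -> rdim C 0 != d -> c C = 0.
  rewrite mulr_sumr big_seq [RHS]big_seq; apply: eq_bigr => C; rewrite mem_Xi => hC.
  rewrite -scalerAr jI_mul //; case: eqP => [_|/eqP nC]; first by rewrite scale1r.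
  by rewrite c0 // !scale0r.
move=> hC nC.
have : \sum_(C <- Xi d) ((v ^- rdim C 0 - v ^- d) * c C) *: e C = 0.
  apply/eqP; move/eqP: h; rewrite -subr_eq0 mulr_sumr scaler_sumr -sumrB; congr (_ == 0).
  rewrite big_seq [RHS]big_seq; apply: eq_bigr => B; rewrite mem_Xi => hB.
  rewrite -scalerAr of_coef_diagl => [|A|//]; last exact: dcoef_diag.
  by rewrite dcoef_Dmx (Dmx_dims _ _).2 !scalerA -scalerBl mulrBl mulrC.
move/sj_free/(_ C hC)/eqP; rewrite mulf_eq0 => /orP[|/eqP //].
rewrite subr_eq0 (inj_eq invr_inj) => /eqP ev.
have lt : (rdim C 0%R < d)%N by rewrite ltn_neqAle nC rdim_le.
have := vX_neq1 (n := (d - rdim C 0%R)%N); rewrite subn_gt0 lt => /(_ isT).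
by rewrite expfB // -ev divff ?eqxx ?vX_neq0.
Qed.

Lemma eigen_d1J_r (x : S) : x * d1J S = v ^- d *: x -> x * jI S = x.
Proof.
have [c ->] := sj_expand x => h.
suff c0 C : in_Xi d C -> cdim C 0 != d -> c C = 0.
  rewrite mulr_suml big_seq [RHS]big_seq; apply: eq_bigr => C; rewrite mem_Xi => hC.
  rewrite -scalerAl mul_jI //; case: eqP => [_|/eqP nC]; first by rewrite scale1r.
  by rewrite c0 // !scale0r.
move=> hC nC.
have : \sum_(C <- Xi d) ((v ^- cdim C 0 - v ^- d) * c C) *: e C = 0.
  apply/eqP; move/eqP: h; rewrite -subr_eq0 mulr_suml scaler_sumr -sumrB; congr (_ == 0).
  rewrite big_seq [RHS]big_seq; apply: eq_bigr => B; rewrite mem_Xi => hB.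
  rewrite -scalerAl of_coef_diagr => [|A|//]; last exact: dcoef_diag.
  by rewrite dcoef_Dmx (Dmx_dims _ _).2 !scalerA -scalerBl mulrBl mulrC.
move/sj_free/(_ C hC)/eqP; rewrite mulf_eq0 => /orP[|/eqP //].
rewrite subr_eq0 (inj_eq invr_inj) => /eqP ev.
have lt : (cdim C 0%R < d)%N by rewrite ltn_neqAle nC cdim_le.
have := vX_neq1 (n := (d - cdim C 0%R)%N); rewrite subn_gt0 lt => /(_ isT).
by rewrite expfB // -ev divff ?eqxx ?vX_neq0.
Qed.
End SchurAlgebra.

(** * Multiplication by t *)

Section Recurrence.
Variables (d : nat) (S : schurJ d).
Local Notation e := (sj_e S).

(** On the right of e, j_d keeps only the positions with V'_1 maximal, and there e is supported on
    the single orbit E. *)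
Lemma ecoef_jI A : in_Xi d A -> (0 < d)%N ->
  ecoef A * (cdim A 0 == d)%:R = (A == Gmx d 0)%:R * v^-1.
Proof.
move=> hA d0; have [g1 g2 g3] := Gmx_dims d0.
have [->|nA] := eqVneq A (Gmx d 0).
  rewrite g2 eqxx mulr1 mul1r /ecoef !mxE /= g1 g2 prednK // eqxx.
  by rewrite cdimE !mxE /= expr1.
rewrite mul0r; have [cA|] := eqVneq (cdim A 0) d; last by rewrite mulr0.
rewrite mulr1 /ecoef; case: and3P => // -[/eqP a1 /eqP a2 /eqP a3].
case/eqP: nA; apply/eqP; rewrite (Xi_eq_max hA (Gmx_Xi d0)) ?cA ?eqxx // g1 g2 g3.
have rA : rdim A 0 = d.-1 by rewrite -cA a3.
have a0 : A 0 0 = d.-1 by rewrite -rA rdimE a1 a2 !addn0.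
by rewrite rA a0 subn0 !eqxx.
Qed.

Lemma fcoef_Dmx A : in_Xi d A -> (0 < d)%N ->
  fcoef A * (cdim A 0 == d.-1)%:R = (A == (Gmx d 0)^T)%:R * v ^- d.-1.
Proof.
move=> hA d0; have [g1 g2 g3] := GmxT_dims d0.
have [->|nA] := eqVneq A (Gmx d 0)^T.
  rewrite g2 eqxx mulr1 mul1r /fcoef g1 g2 !mxE /= prednK // eqxx //.
rewrite mul0r; have [cA|] := eqVneq (cdim A 0) d.-1; last by rewrite mulr0.
rewrite mulr1 /fcoef; case: and3P => // -[/eqP a1 /eqP a2 /eqP a3].
have rA : rdim A 0 = d by rewrite a3 cA prednK.
case/eqP: nA; apply/eqP; rewrite (Xi_eq_max hA (GmxT_Xi d0)) ?rA ?eqxx ?orbT // g1 g2 g3.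
have a0 : A 0 0 = d.-1 by rewrite -cA cdimE a1 a2 !addn0.
by rewrite cA a0 !eqxx.
Qed.

Lemma eJ_jI : (0 < d)%N -> eJ S * jI S = v^-1 *: e (Gmx d 0).
Proof.
move=> d0; rewrite mulr_suml -[e (Gmx d 0)](sum_Xi_delta (d := d) e) ?Gmx_Xi // scaler_sumr.
rewrite big_seq [RHS]big_seq; apply: eq_bigr => A; rewrite mem_Xi => hA.
by rewrite -scalerAl mul_jI // !scalerA ecoef_jI // mulrC.
Qed.

Lemma fJ_Gmx h : (h < d)%N ->
  fJ S * e (Gmx d h) = v ^- d.-1 *: (e (Gmx d 0)^T * e (Gmx d h)).
Proof.
move=> hd; have d0 : (0 < d)%N by apply: leq_ltn_trans hd.
have [g1 g2 g3] := Gmx_dims hd.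
(* The inserted idempotent keeps in f only the positions with V'_1 of dimension d - 1, which leaves
   the single orbit E^T. *)
have -> : e (Gmx d h) = e (Dmx d d.-1) * e (Gmx d h).
  by rewrite sj_Dmxl ?leq_pred ?Gmx_Xi // g1 eqxx scale1r.
rewrite !mulrA scalerAl; congr (_ * _).
rewrite mulr_suml -[e (Gmx d 0)^T](sum_Xi_delta (d := d) e) ?GmxT_Xi // mulr_suml scaler_sumr.
rewrite big_seq [RHS]big_seq; apply: eq_bigr => A; rewrite mem_Xi => hA.
rewrite -!scalerAl sj_Dmxr ?leq_pred // !scalerA fcoef_Dmx // mulrAC -mulrA [X in X *: _]mulrC.
have [->|] := eqVneq A; last by rewrite !mulr0.
by have [_ -> _] := GmxT_dims d0; rewrite eqxx !mulr1.
Qed.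

Lemma kJ_unit : kJ S \is a GRing.unit.
Proof. by rewrite unitrM_comm ?unitrV ?d1J_unit ?d2J_unit //; apply: commrV; exact: d1J_comm_d2J. Qed.

Lemma kJ_jI : kJ S * jI S = (v / v ^+ d) *: jI S.
Proof.
have d2V : (d2J S)^-1 * jI S = v *: jI S.
  apply: (mulrI (d2J_unit S)); rewrite mulVKr ?d2J_unit // -scalerAr d2J_jI scalerA.
  by rewrite mulfV ?v_neq0 // scale1r.
by rewrite /kJ -mulrA d2V -scalerAr d1J_jI scalerA.
Qed.

Lemma kJV_jI : (kJ S)^-1 * jI S = (v ^+ d / v) *: jI S.
Proof.
apply: (mulrI kJ_unit); rewrite mulVKr ?kJ_unit // -scalerAr kJ_jI scalerA.
by rewrite mulrA mulfVK ?v_neq0 // mulfV ?vX_neq0 // scale1r.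
Qed.

Lemma tIE : tI S = fJ S * (eJ S * jI S) + qint (1%:Z - d%:Z) *: jI S.
Proof.
rewrite /tI mulrDl -mulrA -scalerAl mulrBl kJ_jI kJV_jI -scalerBl scalerA; congr (_ + _ *: _).
by rewrite qint_divE expr1 mulrC.
Qed.

Lemma jI_tI : jI S * tI S = tI S.
Proof.
rewrite tIE mulrDr -(scalerAr _ (jI S) (jI S)) jI_idem; congr (_ + _).
have [d0|d0] := posnP d.
  have -> : eJ S * jI S = 0.
    rewrite mulr_suml big_seq big1 // => A; rewrite mem_Xi => hA.
    have -> : ecoef A = 0 by rewrite /ecoef; case: and3P => // -[_ _ /eqP cA]; have := cdim_le hA; rewrite d0 cA.
    by rewrite scale0r mul0r.
  by rewrite !mulr0.
rewrite eJ_jI // -!scalerAr fJ_Gmx // -scalerAr mulrA jI_mul ?GmxT_Xi //.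
by have [-> _ _] := GmxT_dims d0; rewrite eqxx scale1r.
Qed.

Lemma tI_jI : tI S * jI S = tI S.
Proof. by rewrite /tI -mulrA jI_idem. Qed.

Lemma ev_gnum n : ev (gnum n) = ((v ^+ 2) ^+ n - 1) / (v ^+ 2 - 1).
Proof.
have -> : ev (gnum n) = \sum_(i < n) (v ^+ 2) ^+ i.
  rewrite /ev /gnum rmorph_sum /= horner_sum; apply: eq_bigr => i _.
  by rewrite map_polyXn hornerXn.
by rewrite subrX1 mulrAC mulfV ?mul1r // v_sub1_neq0.
Qed.

Lemma jI_stdI b : (b <= d)%N -> jI S * stdI S (d - b) b = stdI S (d - b) b.
Proof.
move=> bd; rewrite /stdI -scalerAr jI_mul ?Aab_Xi_le //.
by have [-> _ _] := Aab_dims_le bd; rewrite eqxx scale1r.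
Qed.

Local Notation len b := ((d - b) * b + (b * b.+1)./2)%N.

Lemma lenS b : (b < d)%N -> (len b.+1 = len b + (d - b))%N.
Proof.
move=> bd; rewrite half_trigS; have -> : (d - b = (d - b.+1).+1)%N by lia.
by rewrite mulSn mulnS; lia.
Qed.

Lemma vlenS b : (b < d)%N -> v ^- len b = v ^- len b.+1 * (v ^+ d / v ^+ b).
Proof.
move=> bd; have -> : v ^+ len b.+1 = v ^+ len b * (v ^+ d / v ^+ b).
  by rewrite lenS // [LHS]exprD expfB.
by rewrite invfM mulfVK // mulf_neq0 ?invr_neq0 ?vX_neq0.
Qed.

Lemma stdI_sj_e b : e (Aab (d - b) b) = v ^+ len b *: stdI S (d - b) b.
Proof. by rewrite /stdI scalerA divff ?vX_neq0 // scale1r. Qed.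

Lemma vinv_mul_pred : (0 < d)%N -> v^-1 * v ^- d.-1 = (v ^+ d)^-1.
Proof. by move=> d0; rewrite -invfM -exprS prednK. Qed.

Let fJ_Gmx_std h : (h < d)%N -> v^-1 *: (fJ S * e (Gmx d h)) =
  (v ^+ d)^-1 *: (ev (gnum h.+1) *: (v ^+ len h.+1 *: stdI S (d - h.+1) h.+1)
    + (v ^+ 2) ^+ h *: (ev (gnum (d - h)) *: (v ^+ len h *: stdI S (d - h) h))).
Proof.
move=> hd; have d0 : (0 < d)%N by apply: leq_ltn_trans hd.
by rewrite fJ_Gmx // scalerA vinv_mul_pred // sj_hyperplane // !stdI_sj_e.
Qed.

Lemma tI_stdI_expand b : (b < d)%N ->
  tI S * stdI S (d - b) b =
  v ^- len b *: (v^-1 *: (fJ S * e (Gmx d b)) + (0 < b)%:R *: (v ^+ 2 *: (v^-1 *: (fJ S * e (Gmx d b.-1)))))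
  + qint (1%:Z - d%:Z) *: stdI S (d - b) b.
Proof.
move=> bd; have d0 : (0 < d)%N by apply: leq_ltn_trans bd. have bd' := ltnW bd.
rewrite tIE mulrDl -(scalerAl _ (jI S)) jI_stdI //; congr (_ + _).
rewrite eJ_jI // /stdI -scalerAr; congr (_ *: _).
rewrite -scalerAr -scalerAl -mulrA sj_cone // mulrDr scalerDr; congr (_ + _).
by rewrite -!scalerAr !scalerA; congr (_ *: _); rewrite mulrC -mulrA.
Qed.

Lemma tI_stdI b : (b < d)%N ->
  tI S * stdI S (d - b) b =
  qint b.+1 *: stdI S (d - b.+1) b.+1 + v ^ (b.*2%:Z - d%:Z) *: stdI S (d - b) b
  + (if b is b'.+1 then (v ^ (b.*2%:Z - d.+1%:Z) * qint (d - b')%N) *: stdI S (d - b') b' else 0).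
Proof.
move=> bd; have d0 : (0 < d)%N by apply: leq_ltn_trans bd.
have V0 := v_neq0; have V1 := v_sub1_neq0 (isT : 0 < 2)%N.
have dbl n : v ^+ n.*2 = (v ^+ n) ^+ 2 by rewrite -exprM muln2.
have sq n : (v ^+ 2) ^+ n = (v ^+ n) ^+ 2 by rewrite exprAC.
have up h : (h < d)%N -> v ^- len h * ((v ^+ d)^-1 * (ev (gnum h.+1) * v ^+ len h.+1)) = qint h.+1.
  move=> hd; rewrite vlenS // ev_gnum qintE sq [v ^+ h.+1]exprSr.
  exact (up_id V0 (vX_neq0 h) V1 (vX_neq0 d) (vX_neq0 (len h.+1))).
have mid : v ^- len b * ((v ^+ d)^-1 * ((v ^+ 2) ^+ b * (ev (gnum (d - b)) * v ^+ len b)))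
    + v ^- len b * (v ^+ 2 * ((v ^+ d)^-1 * (ev (gnum b) * v ^+ len b))) + qint (1%:Z - d%:Z)
    = v ^ (b.*2%:Z - d%:Z).
  rewrite !ev_gnum !sq expfB // expv_divE qint_divE dbl expr1.
  exact (mid_id V0 (vX_neq0 b) V1 (vX_neq0 d) (vX_neq0 (len b))).
have down h : (h < d)%N -> v ^- len h.+1 * (v ^+ 2 * ((v ^+ d)^-1 * ((v ^+ 2) ^+ h * (ev (gnum (d - h)) * v ^+ len h))))
    = v ^ (h.+1.*2%:Z - d.+1%:Z) * qint (d - h)%N.
  move=> hd; have -> : v ^- len h.+1 = v ^- len h * (v ^+ h / v ^+ d).
    have e1 : v ^+ d / v ^+ h * (v ^+ h / v ^+ d) = 1.
      by rewrite mulrA mulfVK ?vX_neq0 // mulfV ?vX_neq0.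
    by rewrite [v ^- len h]vlenS // -[RHS]mulrA e1 mulr1.
  rewrite ev_gnum !sq expfB // expv_divE qintE expfB // dbl [v ^+ h.+1]exprSr [v ^+ d.+1]exprSr.
  exact (down_id V0 (vX_neq0 h) V1 (vX_neq0 d) (vX_neq0 (len h))).
rewrite tI_stdI_expand // fJ_Gmx_std //.
case: b bd mid => [|b] bd mid.
  move: (stdI S (d - 1) 1) (stdI S (d - 0) 0) => X1 X0.
  rewrite scale0r !addr0 !scalerDr !scalerA -!mulrA up // -addrA -scalerDl -mid; congr (_ + _ *: _).
  have -> : ev (gnum 0) = 0 by rewrite ev_gnum expr0 subrr mul0r.
  by rewrite mul0r !mulr0 addr0.
have bd' := ltnW bd.
rewrite ltn0Sn scale1r succnK fJ_Gmx_std // -mid -(up _ bd) -(down _ bd').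
move: (stdI S (d - b.+2) b.+2) (stdI S (d - b.+1) b.+1) (stdI S (d - b) b) => X2 X1 X0.
move: (v ^+ 2) (v ^- len b.+1) (v ^- d) => q L D.
rewrite !scalerDr !scalerDl !scalerA !mulrA -!addrA; congr (_ + (_ + _)).
by congr (_ + _); exact: addrC.
Qed.

End Recurrence.

(** * The canonical basis *)

Section CanonicalElements.
Variables (d : nat) (S : schurJ d).

Definition std (m : nat) : S := stdI S (d - m) m.
Local Notation X := std.

Definition canon (b : nat) : S :=
  \sum_(k < b.+1) canon_coef (d - b) k *: X (b - k).

Lemma canon0 : canon 0 = jI S.
Proof. by rewrite /canon big_ord_recl big_ord0 addr0 canon_coef0 scale1r /std !subn0. Qed.

Lemma qint0 : qint 0 = 0.
Proof. by rewrite /qint subrr mul0r. Qed.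

Lemma tI_canon b : (b < d)%N ->
  tI S * canon b = qint b.+1 *: canon b.+1
    + ((odd (d - b))%:R * qint b) *: canon b.-1.
Proof.
move=> bd; have [a ea] : exists a, (d - b = a.+1)%N by exists (d - b).-1; lia.
have ea' : (d - b.+1 = a)%N by lia.
have ed : d = (a.+1 + b)%N by lia.
have -> : ((odd (d - b))%:R * qint b) *: canon b.-1 =
    \sum_(k < b) ((odd a.+1)%:R * (qint b * canon_coef a.+2 k)) *: X (b - k.+1).
  (* For b = 0 the predecessor is again 0, and the factor [0] removes the term. *)
  rewrite ea; case: b bd ea {ea' ed} => [|b] bd ea.
    by rewrite qint0 mulr0 scale0r big_ord0.
  rewrite /canon (_ : d - b.+1.-1 = a.+2)%N; last by rewrite succnK; lia.
  rewrite scaler_sumr; apply: eq_bigr => k _.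
  by rewrite scalerA -mulrA.
rewrite /canon ea ea' mulr_sumr.
have term (k : 'I_b.+1) : tI S * (canon_coef a.+1 k *: X (b - k)) =
    (canon_coef a.+1 k * qint (b.+1 - k)%N) *: X (b.+1 - k)
    + (canon_coef a.+1 k * v ^ ((b - k).*2%:Z - d%:Z)) *: X (b - k)
    + (if (k < b)%N then (canon_coef a.+1 k * (v ^ ((b - k).*2%:Z - d.+1%:Z) * qint (d - (b - k.+1))%N)) *: X (b - k.+1) else 0).
  have kb : (k <= b)%N by rewrite -ltnS.
  rewrite -scalerAr /std tI_stdI; last by apply: leq_ltn_trans bd; rewrite leq_subr.
  rewrite (subSn kb) !scalerDr !(scalerA (canon_coef a.+1 k)); congr (_ + _).
  have [lt|le] := ltnP k b; last by rewrite (_ : b - k = 0)%N ?scaler0 //; lia.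
  by rewrite (_ : b - k = (b - k.+1).+1)%N ?(scalerA (canon_coef a.+1 k)) //; lia.
rewrite (eq_bigr _ (fun k _ => term k)) {term}; move: std => Y; rewrite !big_split /=.
(* Shifting the index leaves room for a term k = b, which may be added since its factor is [0]. *)
have -> : \sum_(k < b.+1) (canon_coef a.+1 k * qint (b.+1 - k)%N) *: Y (b.+1 - k)%N
    = qint b.+1 *: Y b.+1 + \sum_(k < b.+1) (canon_coef a.+1 k.+1 * qint (b - k)%N) *: Y (b - k)%N.
  rewrite big_ord_recl canon_coef0 mul1r subn0; congr (_ + _).
  rewrite [RHS]big_ord_recr /= subnn qint0 mulr0 scale0r addr0.
  by apply: eq_bigr => k _; rewrite /bump add1n subSS.
have -> : \sum_(k < b.+1) (if (k < b)%N then (canon_coef a.+1 k * (v ^ ((b - k).*2%:Z - d.+1%:Z) * qint (d - (b - k.+1))%N)) *: Y (b - k.+1)%N else 0)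
    = \sum_(k < b) (canon_coef a.+1 k * (v ^ ((b - k).*2%:Z - d.+1%:Z) * qint (d - (b - k.+1))%N)) *: Y (b - k.+1)%N.
  rewrite big_ord_recr /= ltnn addr0; apply: eq_bigr => k _.
  by rewrite ltn_ord.
(* It remains to compare the coefficients of X_(b+1), of X_b ([canon_coef_rec1]) and of the
   X_(b-k-1) ([canon_coef_rec]). *)
rewrite [in RHS]big_ord_recl canon_coef0 scale1r subn0 scalerDr -!addrA; congr (_ + _).
rewrite addrA -big_split /= [in RHS]big_ord_recl big_ord_recl scalerDr -[LHS]addrA -[RHS]addrA; congr (_ + _).
  rewrite /bump /= subn0 -scalerDl; rewrite scalerA.
  congr (_ *: Y _); last by rewrite addn0 subSS subn0.
  by rewrite canon_coef0 mul1r -canon_coef_rec1 ed.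
rewrite scaler_sumr -!big_split /=; apply: eq_bigr => k _.
rewrite /bump !add1n subSS.
rewrite -!scalerDl scalerA -scalerDl; congr (_ *: _).
have kb := ltn_ord k.
rewrite -canon_coef_rec; congr (_ * _ + _ * _ + _ * _).
- by congr qint; lia.
- by congr (v ^ _); lia.
- by congr (v ^ _ * qint _); lia.
Qed.

Definition std_coord m (x : S) : Qv :=
  v ^+ ((d - m) * m + (m * m.+1)./2) * sj_coord (Aab (d - m) m) x.

Lemma std_coordD m x y : std_coord m (x + y) = std_coord m x + std_coord m y.
Proof. by rewrite /std_coord sj_coordD mulrDr. Qed.

Lemma std_coordZ m a x : std_coord m (a *: x) = a * std_coord m x.
Proof. by rewrite /std_coord sj_coordZ mulrCA. Qed.

Lemma std_coord0 m : std_coord m 0 = 0.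
Proof. by rewrite -(scale0r 0) std_coordZ mul0r. Qed.

Lemma std_coord_std m n : (m <= d)%N -> (n <= d)%N -> std_coord m (std n) = (m == n)%:R.
Proof.
move=> md nd; rewrite /std_coord /std /stdI sj_coordZ sj_coord_e ?Aab_Xi_le // Aab_inj //.
by case: eqP => [->|]; rewrite ?mulr0 // mulr1 divff ?vX_neq0.
Qed.

Lemma std_coord_sum m n (c : nat -> Qv) (f : nat -> S) :
  std_coord m (\sum_(i < n) c i *: f i) = \sum_(i < n) c i * std_coord m (f i).
Proof.
elim: n => [|n IH]; first by rewrite !big_ord0 std_coord0.
by rewrite !big_ord_recr /= std_coordD std_coordZ IH.
Qed.

Lemma canon_lower b : exists g : nat -> Qv, (forall m, in_vinvZ (g m)) /\
  canon b = std b + \sum_(m < b) g m *: std m.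
Proof.
exists (fun m => if (m < b)%N then canon_coef (d - b) (b - m) else 0); split=> [m|].
  case: ifP => [mb|_]; last exact: in_vinvZ0.
  by apply: in_vinvZ_canon_coef; rewrite subn_gt0.
rewrite /canon big_ord_recl canon_coef0 scale1r subn0; congr (_ + _).
rewrite (reindex_inj rev_ord_inj); apply: eq_bigr => k _ /=.
have kb := ltn_ord k; rewrite kb /bump /= add1n.
by congr (canon_coef _ _ *: std _); lia.
Qed.

Lemma canon_free n (c : nat -> Qv) : (n <= d.+1)%N ->
  \sum_(m < n) c m *: canon m = 0 -> forall m, (m < n)%N -> c m = 0.
Proof.
elim: n => // n IH nd; rewrite big_ord_recr /= => c0.
have coordn m : (m <= n)%N -> std_coord n (canon m) = (m == n)%:R.
  move=> mn; have [g [_ ->]] := canon_lower m.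
  rewrite std_coordD std_coord_sum std_coord_std //; last by apply: leq_trans mn _.
  rewrite big1 ?addr0 1?eq_sym // => i _; rewrite std_coord_std //.
    by rewrite gtn_eqF ?mulr0 //; apply: leq_trans (ltn_ord i) mn.
  by apply: leq_trans (ltnW (ltn_ord i)) _; apply: leq_trans mn _.
have cn : c n = 0.
  have := congr1 (std_coord n) c0; rewrite std_coord0 std_coordD std_coordZ std_coord_sum coordn //.
  rewrite eqxx mulr1 big1 ?add0r // => i _; rewrite coordn 1?ltnW //.
  by rewrite ltn_eqF ?mulr0.
move: c0; rewrite cn scale0r addr0 => c0 m; rewrite ltnS leq_eqVlt => /predU1P[->//|].
exact: IH (ltnW nd) c0 m.
Qed.

(** The change of basis is unitriangular with off-diagonal entries in v^-1 Z[v^-1]. This set is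
    closed under products and differences, so eliminating the top term keeps the coefficients in
    it. *)
Lemma std_to_canon n (c : nat -> Qv) : (forall m, in_vinvZ (c m)) ->
  exists c' : nat -> Qv, (forall m, in_vinvZ (c' m)) /\
    \sum_(m < n) c m *: std m = \sum_(m < n) c' m *: canon m.
Proof.
elim: n c => [|n IH] c cZ; first by exists c; rewrite !big_ord0.
have [g [gZ eg]] := canon_lower n.
have c1Z m : in_vinvZ (c m - c n * g m).
  by apply: in_vinvZD => //; apply: in_vinvZN; exact: in_vinvZM.
have [c' [c'Z ec']] := IH _ c1Z.
exists (fun m => if m == n then c n else c' m); split; first by move=> m; case: ifP.
rewrite !big_ord_recr /= eqxx.
have -> : \sum_(m < n) (if m == n :> nat then c n else c' m) *: canon m = \sum_(m < n) c' m *: canon m.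
  by apply: eq_bigr => m _; rewrite ltn_eqF.
rewrite -ec' eg scalerDr addrCA addrC; congr (_ + _).
rewrite scaler_sumr -big_split /=; apply: eq_bigr => m _.
by rewrite scalerA -scalerDl subrK.
Qed.
End CanonicalElements.

(** * The bar involution *)

Lemma map_intr_horner_v (p : {poly int}) :
  (map_poly intr p).[v] = FracField.tofrac (map_poly intr p : {poly rat}).
Proof.
elim/poly_ind: p => [|p c IH]; first by rewrite !map_poly0 horner0 tofrac0.
rewrite !rmorphD !rmorphM /= !map_polyX !map_polyC hornerMXaddC IH.
by congr (_ + _); rewrite !rmorph_int.
Qed.

Lemma map_intr_v_inj (p q : {poly int}) :
  (map_poly intr p).[v] = (map_poly intr q).[v] -> p = q.
Proof.
rewrite !map_intr_horner_v => /eqP; rewrite tofrac_eq => /eqP.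
by apply: map_inj_poly => // x y /eqP; rewrite eqr_int => /eqP.
Qed.

Lemma qint_neq0 (n : nat) : qint n.+1 != 0.
Proof.
have h (k : nat) : v ^+ k.+1 - (v ^+ k.+1)^-1 != 0.
  by apply: sub_inv_neq0; rewrite ?vX_neq0 // -exprM; exact: v_sub1_neq0.
by rewrite qintE mulf_neq0 ?h // invr_neq0 // -[v]expr1 h.
Qed.

Section Bar.
Variables (d : nat) (S : schurJ d) (bar : {rmorphism S -> S}).
Hypothesis hbar : bar_involution bar.

(** A relation rather than an involution of Q(v): bar is given only on S, and its effect on scalars
    is propagated from v by the field operations. *)
Definition bar_scalar (a a' : Qv) := bar (a%:A) = a'%:A.

Lemma bar_scalarZ a a' x : bar_scalar a a' -> bar (a *: x) = a' *: bar x.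
Proof. by move=> h; rewrite -mulr_algl rmorphM h mulr_algl. Qed.

Lemma bar_scalar0 : bar_scalar 0 0.
Proof. by rewrite /bar_scalar !scale0r rmorph0. Qed.

Lemma bar_scalar1 : bar_scalar 1 1.
Proof. by rewrite /bar_scalar !scale1r rmorph1. Qed.

Lemma bar_scalarD a a' b b' : bar_scalar a a' -> bar_scalar b b' -> bar_scalar (a + b) (a' + b').
Proof. by rewrite /bar_scalar => ha hb; rewrite !scalerDl rmorphD ha hb. Qed.

Lemma bar_scalarN a a' : bar_scalar a a' -> bar_scalar (- a) (- a').
Proof. by rewrite /bar_scalar => ha; rewrite !scaleNr rmorphN ha. Qed.

Lemma bar_scalarM a a' b b' : bar_scalar a a' -> bar_scalar b b' -> bar_scalar (a * b) (a' * b').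
Proof.
by move=> ha hb; rewrite /bar_scalar -scalerA (bar_scalarZ _ ha) hb scalerA.
Qed.

Lemma bar_scalarV a a' : bar_scalar a a' -> bar_scalar a^-1 a'^-1.
Proof.
have [->|a0] := eqVneq a 0.
  rewrite /bar_scalar scale0r rmorph0 => /esym/eqP; rewrite scaler_eq0 oner_eq0 orbF => /eqP ->.
  by rewrite invr0 !scale0r rmorph0.
move=> h; have e : 1 = a' *: bar (a^-1%:A).
  by rewrite -(bar_scalarZ _ h) scalerA mulfV // scale1r rmorph1.
have a'0 : a' != 0 by apply: contra_eq_neq e => ->; rewrite scale0r oner_eq0.
by apply: (scalerI a'0); rewrite -e scalerA mulfV // scale1r.
Qed.

Lemma bar_scalarX a a' n : bar_scalar a a' -> bar_scalar (a ^+ n) (a' ^+ n).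
Proof.
move=> h; elim: n => [|n IH]; first exact: bar_scalar1.
by rewrite !exprS; apply: bar_scalarM.
Qed.

Lemma bar_scalar_int (n : int) : bar_scalar n%:~R n%:~R.
Proof. by rewrite /bar_scalar scaler_int rmorph_int. Qed.

Lemma bar_v : bar_scalar v v^-1.
Proof. by case: hbar. Qed.

Lemma bar_vV : bar_scalar v^-1 v.
Proof. by rewrite -[X in bar_scalar _ X]invrK; apply: bar_scalarV; exact: bar_v. Qed.

Lemma bar_inv_vBvV : bar_scalar (v - v^-1)^-1 (- (v - v^-1)^-1).
Proof.
rewrite -(invrN (v - v^-1)) opprB; apply: bar_scalarV; apply: bar_scalarD; first exact: bar_v.
by apply: bar_scalarN; exact: bar_vV.
Qed.

Lemma bar_qint (n : nat) : bar_scalar (qint n) (qint n).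
Proof.
rewrite qintE -[X in bar_scalar _ X]mulrNN opprB.
apply: bar_scalarM bar_inv_vBvV; apply: bar_scalarD.
  by rewrite -exprVn; apply: bar_scalarX; exact: bar_v.
by apply: bar_scalarN; rewrite -exprVn; apply: bar_scalarX; exact: bar_vV.
Qed.

Lemma bar_poly_vV (p : {poly int}) :
  bar_scalar (map_poly intr p).[v^-1] (map_poly intr p).[v].
Proof.
elim/poly_ind: p => [|p c IH]; first by rewrite !map_poly0 !horner0; exact: bar_scalar0.
rewrite !rmorphD !rmorphM /= !map_polyX !map_polyC !hornerMXaddC.
by apply: bar_scalarD (bar_scalar_int c); apply: bar_scalarM IH bar_vV.
Qed.

(** Applying bar to the eigenvalue equations of j_d for d_1 shows that bar j_d satisfies them too,
    so j_d absorbs into bar j_d on both sides. Applying bar to one of these two identities gives bar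
    j_d * j_d = j_d, and the other says that this product is bar j_d. *)
Lemma bar_jI : bar (jI S) = jI S.
Proof.
have [_ _ _ [bd1 _]] := hbar.
have u1 := d1J_unit S.
have vd : bar_scalar (v ^- d) (v ^+ d).
  by rewrite -exprVn; apply: bar_scalarX; exact: bar_vV.
have l1 : (d1J S)^-1 * bar (jI S) = v ^+ d *: bar (jI S).
  by rewrite -bd1 -rmorphM d1J_jI (bar_scalarZ _ vd).
have r1 : bar (jI S) * (d1J S)^-1 = v ^+ d *: bar (jI S).
  by rewrite -bd1 -rmorphM jI_d1J (bar_scalarZ _ vd).
have l : jI S * bar (jI S) = bar (jI S).
  apply: eigen_d1J_l; rewrite -[in RHS](mulVKr u1 (bar (jI S))) l1 -scalerAr scalerA.
  by rewrite mulVf ?vX_neq0 // scale1r.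
have r : bar (jI S) * jI S = bar (jI S).
  apply: eigen_d1J_r; rewrite -[in RHS](mulrVK u1 (bar (jI S))) r1 -scalerAl scalerA.
  by rewrite mulVf ?vX_neq0 // scale1r.
have [bb _ _ _] := hbar.
by have := congr1 bar l; rewrite rmorphM bb r.
Qed.

Lemma bar_tI : bar (tI S) = tI S.
Proof.
have [_ _ [be bf] [bd1 bd2]] := hbar.
have u1 := d1J_unit S; have u2 := d2J_unit S.
have kV : (kJ S)^-1 = d2J S / d1J S by rewrite /kJ invrM ?unitrV // invrK.
have bk : bar (kJ S) = (kJ S)^-1.
  rewrite kV /kJ rmorphM /= bd1 rmorphV // bd2 invrK.
  by apply/esym; apply: commrV; exact: esym (d1J_comm_d2J S).
have bkV : bar (kJ S)^-1 = kJ S by rewrite rmorphV ?kJ_unit // bk invrK.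
rewrite /tI rmorphM bar_jI rmorphD rmorphM be bf (bar_scalarZ _ bar_inv_vBvV).
by rewrite rmorphB bk bkV scaleNr -scalerN opprB.
Qed.

Lemma bar_canon b : (b <= d)%N -> bar (canon S b) = canon S b.
Proof.
(* The recursion reaches back two steps, so two consecutive elements are carried along. *)
suff : (b <= d)%N -> bar (canon S b) = canon S b /\ bar (canon S b.-1) = canon S b.-1 by move=> h /h[].
elim: b => [|b IH] bd; first by rewrite canon0 bar_jI.
have [IH1 IH2] := IH (ltnW bd); split=> //.
have rec := tI_canon S bd.
have q0 : qint b.+1 != 0 by rewrite qint_neq0.
apply: (scalerI q0); rewrite -(bar_scalarZ _ (bar_qint b.+1)).
have -> : qint b.+1 *: canon S b.+1 = tI S * canon S b - ((odd (d - b))%:R * qint b) *: canon S b.-1.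
  by rewrite rec addrK.
rewrite rmorphB rmorphM bar_tI IH1; congr (_ - _).
rewrite (bar_scalarZ (a' := (odd (d - b))%:R * qint b)) ?IH2 //.
by apply: bar_scalarM (bar_qint b); exact: (bar_scalar_int (odd (d - b))%:Z).
Qed.

(** Here c = v^-1 p(v^-1) is also v p(v). With n = [size p] this gives v^n p(v^-1) = v^(n+2) p(v).
    The left side, [Q] at v, is the reversal of p and has degree at most n, while the right side is
    divisible by v^(n+2); as v is transcendental, p = 0. *)
Lemma bar_fixed_vinvZ c : in_vinvZ c -> bar c%:A = c%:A -> c = 0.
Proof.
move=> [p ec] fixc.
have ec' : c = v * (map_poly intr p).[v].
  have : bar_scalar c (v * (map_poly intr p).[v]).
    by rewrite ec; apply: bar_scalarM; [exact: bar_vV | exact: bar_poly_vV].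
  rewrite /bar_scalar fixc => /eqP; rewrite -subr_eq0 -scalerBl scaler_eq0 oner_eq0 orbF subr_eq0.
  by move/eqP.
suff p0 : p = 0 by rewrite ec p0 map_poly0 horner0 mulr0.
pose n := size p; pose Q : {poly int} := \sum_(i < n) p`_i *: 'X^(n - i).
have sp : (size (map_poly intr p : {poly Qv}) <= n)%N by exact: size_poly.
have eQ : Q = 'X^(n.+2) * p.
  apply: map_intr_v_inj; rewrite rmorphM /= map_polyXn hornerM hornerXn.
  rewrite rmorph_sum /= horner_sum.
  have -> : v ^+ n.+2 * (map_poly intr p).[v] = v ^+ n * (map_poly intr p).[v^-1].
    have -> : v ^+ n.+2 * (map_poly intr p).[v] = v ^+ n.+1 * c by rewrite ec' mulrA -exprSr.
    by rewrite ec mulrA exprSr mulfK ?v_neq0.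
  rewrite (horner_coef_wide _ sp) mulr_sumr; apply: eq_bigr => i _.
  rewrite map_polyZ map_polyXn hornerZ hornerXn coef_map mulrCA; congr (_ * _).
  have lt := ltn_ord i.
  by rewrite expfB // exprVn.
apply/polyP => k; rewrite coef0.
have [kn|nk] := ltnP k n; last by rewrite nth_default.
have := congr1 (fun q : {poly int} => q`_(n - k)) eQ; rewrite coefXnM.
have -> : (n - k < n.+2)%N by rewrite ltnS (leq_trans (leq_subr _ _)).
rewrite coef_sum (bigD1 (Ordinal kn)) //= coefZ coefXn eqxx mulr1 big1 ?addr0 // => l lk.
rewrite coefZ coefXn; case: eqP => [e|]; last by rewrite mulr0.
case/eqP: lk; apply: val_inj => /=; have := ltn_ord l; move: e kn; clear; lia.
Qed.

End Bar.

(** * Uniqueness and polynomial formulas *)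

Section Uniqueness.
Variables (d : nat) (S : schurJ d) (bar : {rmorphism S -> S}).
Hypothesis hbar : bar_involution bar.

Lemma canon_is_canonical b : (b <= d)%N -> is_canonical bar b (canon S b).
Proof.
move=> bd; split; first exact: bar_canon.
have [g [gZ eg]] := canon_lower S b.
by exists (fun i : 'I_b => g i).
Qed.

Lemma bar_scalar_vinvZ n (c : nat -> Qv) : (forall m, in_vinvZ (c m)) ->
  exists c', forall m, (m < n)%N -> bar_scalar bar (c m) (c' m).
Proof.
move=> cZ; elim: n => [|n [c' IH]]; first by exists c.
have [p ep] := cZ n.
exists (fun m => if m == n then v * (map_poly intr p).[v] else c' m) => m.
rewrite ltnS leq_eqVlt; case: eqP => [-> _|_ /= mn]; last exact: IH.
by rewrite ep; apply: bar_scalarM; [exact: bar_vV | exact: bar_poly_vV].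
Qed.

(** The difference of two candidates is a combination of the B_m with m < b and coefficients in v^-1
    Z[v^-1]. The B_m are independent and fixed by bar, so each coefficient is fixed as well, hence
    zero. *)
Lemma canonical_unique b x : (b <= d)%N -> is_canonical bar b x -> x = canon S b.
Proof.
move=> bd [barx [c [cZ ex]]].
have [g [gZ eg]] := canon_lower S b.
pose f m := (if insub m is Some i then c i else 0) - g m.
have fZ m : in_vinvZ (f m).
  rewrite /f; apply: in_vinvZD; last exact: in_vinvZN.
  by case: insub => [i|]; [exact: cZ | exact: in_vinvZ0].
have [f' [f'Z ef]] := std_to_canon S b fZ.
have ey : x - canon S b = \sum_(m < b) f' m *: canon S m.
  rewrite -ef ex eg /std opprD addrACA subrr add0r -sumrB; apply: eq_bigr => i _.
  by rewrite /f valK scalerBl.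
have [f1 hf1] := bar_scalar_vinvZ b f'Z.
have fixy : bar (x - canon S b) = x - canon S b.
  by rewrite rmorphB barx (bar_canon hbar bd).
have : \sum_(m < b) (f1 m - f' m) *: canon S m = 0.
  have -> : \sum_(m < b) (f1 m - f' m) *: canon S m =
     bar (\sum_(m < b) f' m *: canon S m) - \sum_(m < b) f' m *: canon S m.
    rewrite rmorph_sum -sumrB; apply: eq_bigr => m _.
    rewrite scalerBl (bar_scalarZ _ (hf1 _ (ltn_ord m))) (bar_canon hbar) //.
    by apply: leq_trans (ltnW (ltn_ord m)) bd.
  by rewrite -ey fixy subrr.
move/(canon_free (c := fun m => f1 m - f' m) (leq_trans bd (leqnSn d))) => f0.
apply/eqP; rewrite -subr_eq0 ey big1 // => m _.
have /eqP := f0 m (ltn_ord m); rewrite subr_eq0 => /eqP em.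
have := hf1 m (ltn_ord m); rewrite em => fixf.
by rewrite (bar_fixed_vinvZ hbar (f'Z m) fixf) scale0r.
Qed.
End Uniqueness.

Lemma mul_conj (R : comNzRingType) (x c w : R) :
  (x + c) * w * (x - c) = x * (x * w) - c ^+ 2 * w.
Proof. ring. Qed.

Section Polynomials.
Variables (d : nat) (S : schurJ d).

Lemma phiID p q : phiI S (p + q) = phiI S p + phiI S q.
Proof. by rewrite /phiI rmorphD mulrDl. Qed.

Lemma phiIB p q : phiI S (p - q) = phiI S p - phiI S q.
Proof. by rewrite /phiI rmorphB mulrBl. Qed.

Lemma phiIZ c p : phiI S (c *: p) = c *: phiI S p.
Proof. by rewrite -mul_polyC /phiI rmorphM /= horner_algC -mulrA mulr_algl. Qed.

Lemma phiIX p : phiI S ('X * p) = tI S * phiI S p.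
Proof. by rewrite /phiI rmorphM /= horner_algX mulrA. Qed.

Lemma phiI1 : phiI S 1 = jI S.
Proof. by rewrite /phiI rmorph1 mul1r. Qed.

Lemma phiI_jI p : phiI S p * jI S = phiI S p.
Proof. by rewrite /phiI -mulrA jI_idem. Qed.

Lemma jI_phiI p : jI S * phiI S p = phiI S p.
Proof.
elim/poly_ind: p => [|p c IH]; first by rewrite /phiI rmorph0 mul0r mulr0.
have -> : p * 'X + c%:P = 'X * p + c *: 1 by rewrite mulrC alg_polyC.
by rewrite phiID phiIX phiIZ phiI1 mulrDr mulrA jI_tI -(scalerAr _ (jI S) (jI S)) jI_idem.
Qed.

Lemma phiI_in_SI p : phiI S p \in SI S.
Proof.
by rewrite -phiI_jI -jI_phiI; apply: memv_mul; [apply: memv_mul; rewrite ?memv_line ?memvf | rewrite memv_line].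
Qed.

Lemma tI_in_SI : tI S \in SI S.
Proof.
rewrite -tI_jI -jI_tI; apply: memv_mul; last exact: memv_line.
by apply: memv_mul; rewrite ?memv_line ?memvf.
Qed.

Lemma jI_in_SI : jI S \in SI S.
Proof. by rewrite -phiI1 phiI_in_SI. Qed.

Definition iprod (n : nat) : {poly Qv} :=
  \prod_(1 <= i < n.+1) ('X + (qint (n%:Z + 1 - 2 * i%:Z))%:P).

Lemma iprod0 : iprod 0 = 1.
Proof. by rewrite /iprod big_nil. Qed.

Lemma iprod1 : iprod 1 = 'X.
Proof. by rewrite /iprod big_nat1 subrr qint0 addr0. Qed.

(** The first and last factors are X + [n+1] and X - [n+1]; the others, reindexed, form
    [iprod n]. *)
Lemma iprodSS n : iprod n.+2 = 'X * ('X * iprod n) - (qint n.+1 ^+ 2) *: iprod n.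
Proof.
have -> : iprod n.+2 = ('X + (qint n.+1)%:P) * iprod n * ('X - (qint n.+1)%:P).
  rewrite {1}/iprod big_nat_recr //= big_ltn // big_add1 /=.
  have -> : n.+2%:Z + 1 - 2 * 1%:Z = n.+1%:Z by lia.
  have -> : n.+2%:Z + 1 - 2 * n.+2%:Z = - n.+1%:Z by lia.
  have eP : \prod_(1 <= i < n.+1) ('X + (qint (n.+2%:Z + 1 - 2 * i.+1%:Z))%:P) = iprod n.
    by apply: eq_bigr => i _; rewrite (_ : n.+2%:Z + 1 - 2 * i.+1%:Z = n%:Z + 1 - 2 * i%:Z) //; lia.
  by rewrite eP qintN polyCN.
by rewrite mul_conj -mul_polyC polyC_exp.
Qed.

Lemma qfactS n : qfact n.+1 = qfact n * qint n.+1.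
Proof. by rewrite /qfact big_nat_recr. Qed.

Lemma qfact_neq0 n : qfact n != 0.
Proof.
elim: n => [|n IH]; first by rewrite /qfact big_nil oner_eq0.
by rewrite qfactS mulf_neq0 ?qint_neq0.
Qed.

Lemma canon_succ n : (n < d)%N -> ~~ odd (d - n) ->
  qfact n *: canon S n = phiI S (iprod n) ->
  qfact n.+1 *: canon S n.+1 = phiI S ('X * iprod n).
Proof.
move=> nd even h; have := tI_canon S nd; rewrite (negbTE even) mul0r scale0r addr0 => rec.
by rewrite qfactS -scalerA -rec scalerAr h phiIX.
Qed.

Lemma canon_iprod n : (n <= d)%N -> ~~ odd (d - n) ->
  qfact n *: canon S n = phiI S (iprod n).
Proof.
(* Since n keeps the parity of d, the induction advances by two, and the claim is carried for n and
   n + 1. *)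
suff : ((n <= d)%N -> ~~ odd (d - n) -> qfact n *: canon S n = phiI S (iprod n)) /\
  ((n.+1 <= d)%N -> ~~ odd (d - n.+1) -> qfact n.+1 *: canon S n.+1 = phiI S (iprod n.+1)) by case.
elim: n => [|n [IH1 IH2]].
  rewrite iprod0 phiI1 canon0 {1}/qfact big_nil scale1r; split=> // d0 _.
  have := tI_canon S d0; rewrite qint0 mulr0 scale0r addr0 canon0 => rec.
  by rewrite qfactS {1}/qfact big_nil mul1r -rec iprod1 -[X in phiI S X]mulr1 phiIX phiI1.
split=> // nd ev.
have ev' : ~~ odd (d - n) by move: ev nd; clear; lia.
have nd1 : (n.+1 < d)%N by []; have nd0 : (n < d)%N by apply: ltnW.
have e0 := IH1 (ltnW nd0) ev'; have e1 := canon_succ nd0 ev' e0.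
have od : odd (d - n.+1) by move: ev nd; clear; lia.
have rec : qint n.+2 *: canon S n.+2 = tI S * canon S n.+1 - qint n.+1 *: canon S n.
  by rewrite (tI_canon S nd1) od mul1r succnK addrK.
rewrite qfactS -scalerA rec scalerBr scalerAr e1 scalerA.
rewrite iprodSS phiIB phiIZ !phiIX; congr (_ - _).
by rewrite -e0 scalerA qfactS expr2 [X in _ = X *: _]mulrC -[X in X *: _]mulrA.
Qed.
End Polynomials.

(** * The limit *)

Section Limit.
Variables (S : forall d : nat, schurJ d) (bar : forall d : nat, {rmorphism S d -> S d}).
Hypothesis hbar : forall d : nat, bar_involution (bar d).
Variable phi : forall d : nat, S d.+2 -> S d.
Hypothesis hphi : forall d : nat, transfer (@phi d).

Lemma transfer_phiI d P : phi (phiI (S d.+2) P) = phiI (S d) P.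
Proof.
have [_ lin mul pj pt] := hphi d.
elim/poly_ind: P => [|P c IH].
  (* [phi] is linear only on [SI]; applied to -j_d + j_d this gives [phi 0 = 0]. *)
  have := lin (-1) _ _ (jI_in_SI (S d.+2)) (jI_in_SI (S d.+2)).
  by rewrite /phiI !rmorph0 !mul0r !scaleN1r !addNr.
have -> : P * 'X + c%:P = c *: 1 + 'X * P by rewrite addrC mulrC alg_polyC.
rewrite !phiID !phiIZ !phiIX !phiI1 lin ?jI_in_SI //; last first.
  by rewrite -phiIX phiI_in_SI.
by rewrite mul ?tI_in_SI ?phiI_in_SI // pj pt IH.
Qed.

(** P does not depend on p. Uniqueness of the canonical basis element gives the components far out
    in the limit, and the transfer maps carry the equality down to all the others. *)
Lemma bcheck_family a b (P : {poly Qv}) :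
  (forall p, canon (S (a + b + p.*2)) b = phiI (S (a + b + p.*2)) P) ->
  forall x : (forall n, S n),
  is_bcheck bar phi a b x <-> eq_limit (odd (a + b)) x (family_of_poly S P).
Proof.
move=> hP x; split=> [[lim [p0 can]]|xP].
  have high p m : (p0 <= p)%N -> m = (a + b + p.*2)%N -> x m = phiI (S m) P.
    move=> p0p ->; rewrite -hP; apply: (canonical_unique (hbar _)); last exact: can.
    by rewrite -addnA addnCA leq_addr.
  have down k n : odd n = odd (a + b) -> x (n + k.*2)%N = phiI (S _) P -> x n = phiI (S n) P.
    elim: k n => [|k IH] n on; first by rewrite addn0.
    rewrite doubleS addnS addnS -addSn -addSn => e.
    have [_ <-] := lim n on.
    by rewrite (IH n.+2) ?transfer_phiI //= negbK.
  (* Chosen so that n + 2k = a + b + 2 (p0 + n), an index past the bound and at least n. *)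
  move=> n on; pose k := (a + b + (p0 + n).*2 - n)./2.
  apply: (down k n on); apply: (high (p0 + n)%N); first exact: leq_addr.
  rewrite /k; move: on; clear; lia.
split=> [n on|].
  rewrite (xP n on) (xP n.+2) /= ?negbK //; split; first exact: phiI_in_SI.
  exact: transfer_phiI.
exists 0%N => p _.
rewrite (xP (a + b + p.*2)%N); last by rewrite oddD odd_double addbF.
rewrite /family_of_poly -hP; apply: canon_is_canonical; first exact: hbar.
by rewrite -addnA addnCA leq_addr.
Qed.
End Limit.

Theorem theorem4
  (S : forall d : nat, schurJ d)
  (bar : forall d : nat, {rmorphism S d -> S d})
  (hbar : forall d : nat, bar_involution (bar d))
  (phi : forall d : nat, S d.+2 -> S d)
  (hphi : forall d : nat, transfer (phi d))
  (d : nat) :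
  (forall x : (forall n : nat, S n),
     is_bcheck bar phi 0 d x <->
     eq_limit (odd d) x
       (family_of_poly S
          ((qfact d)^-1 *:
             \prod_(1 <= i < d.+1)
                ('X + (qint (d%:Z + 1 - 2 * i%:Z))%:P)))) /\
  (forall x : (forall n : nat, S n),
     is_bcheck bar phi 1 d.+1 x <->
     eq_limit (odd d) x
       (family_of_poly S
          ((qfact d.+1)^-1 *:
             ('X * \prod_(1 <= i < d.+1)
                ('X + (qint (d%:Z + 1 - 2 * i%:Z))%:P))))).
Proof.
split; first apply: (bcheck_family hbar hphi (a := 0)) => p.
  apply: (scalerI (qfact_neq0 d)); rewrite phiIZ scalerA mulfV ?qfact_neq0 // scale1r.
  by apply: canon_iprod; lia.
have -> : odd d = odd (1 + d.+1) by rewrite /= negbK.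
apply: (bcheck_family hbar hphi (a := 1)) => p.
apply: (scalerI (qfact_neq0 d.+1)); rewrite phiIZ scalerA mulfV ?qfact_neq0 // scale1r.
(* The component has index d + 2 + 2p, which differs from d by an even number; so B_(d+1) is one
   multiplication by t away from B_d. *)
by apply: canon_succ; [lia | lia | apply: canon_iprod; lia].
Qed.
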